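(* Let $N$ be pseudoregular, with Lie algebra $\mathfrak n=\mathfrak z\oplus\mathfrak v$. Then the following are equivalent: (i) for every geodesic $\gamma$ of $N$ with $\gamma(0)=1\in N$ and $\dot\gamma(0)=z_0+x_0$, where $z_0\in\mathfrak z$, $x_0\in\mathfrak v$ and $|z_0|\neq0$, there exists a connected, totally geodesic, 3-dimensional submanifold $H$ of $N$ (with $1\in H$) such that $\dot\gamma(0)\in\mathfrak h=T_1H$ and $\mathfrak h\cap\mathfrak z$ is nonnull; (ii) the metric tensor on $N$ is homothetic to one of pseudo$H$-type.
   Context: An inner product on a real vector space means a nondegenerate symmetric bilinear form, not necessarily definite. $N$ is a simply connected 2-step nilpotent (real, finite-dimensional) Lie group with Lie algebra $\mathfrak n$ and center $\mathfrak z$; $\langle\,,\rangle$ denotes an inner product on $\mathfrak n$ and also the induced left-invariant pseudoriemannian metric tensor on $N$. It is assumed that $\mathfrak z$ is nondegenerate with respect to $\langle\,,\rangle$; put $\mathfrak v=\mathfrak z^\perp$, so $\mathfrak n=\mathfrak z\oplus\mathfrak v$. A vector $v$ is null if $\langle v,v\rangle=0$ and nonnull otherwise; $|v|=\sqrt{|\langle v,v\rangle|}$. The subspace $\mathfrak h\cap\mathfrak z$ being nonnull means that it contains a vector $z'$ with $\langle z',z'\rangle\ne0$. For $z\in\mathfrak z$, the operator $J_z:\mathfrak v\to\mathfrak v$ is defined by $\langle J_z x,y\rangle=\langle z,[x,y]\rangle$ for $x,y\in\mathfrak v$. $N$ is pseudoregular if and only if (1) $\operatorname{ad}_x:\mathfrak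 n\to\mathfrak z$ is surjective for every nonnull $x\in\mathfrak v$, and (2) $J_z$ is nonsingular for every nonnull $z\in\mathfrak z$. $N$ (with its metric tensor) is of pseudo$H$-type if and only if $J_z^2=-\langle z,z\rangle I$ on $\mathfrak v$ for every $z\in\mathfrak z$. The metric tensor is homothetic to one of pseudo$H$-type if there is a nonzero real constant $c$ such that $N$ with the metric tensor $c\langle\,,\rangle$ is of pseudo$H$-type. ''Totally geodesic'' is used in the extended sense of O'Neill, which applies to possibly degenerate submanifolds: a submanifold $H$ (whose induced metric may be degenerate) is totally geodesic if, for the Levi-Civita connection $\nabla$ of $N$, $\nabla_VW$ is tangent to $H$ whenever $V,W$ are vector fields tangent to $H$. *)

(* Defs.v *)
From HB Require Import structures.
From mathcomp Require Import all_boot all_order all_algebra.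
From mathcomp Require Import all_classical all_reals all_analysis.

Set Implicit Arguments.
Unset Strict Implicit.
Unset Printing Implicit Defensive.

Import Order.TTheory GRing.Theory Num.Theory.
Import numFieldNormedType.Exports.

Local Open Scope classical_set_scope.
Local Open Scope ring_scope.

(* A finite-dimensional real Lie algebra is 'rV[R]_n with a bracket [br].  The
   simply connected Lie group N of a 2-step nilpotent Lie algebra is taken in
   exponential coordinates: exp is a diffeomorphism from the Lie algebra onto
   N, so N is 'rV[R]_n with the Baker-Campbell-Hausdorff product [grp_mul],
   identity element 0, and T_0 N is the Lie algebra itself. *)

Section Algebra.
Context {R : realType} {n : nat}.
Implicit Types (br : 'rV[R]_n -> 'rV[R]_n -> 'rV[R]_n).
Implicit Types (ip : 'rV[R]_n -> 'rV[R]_n -> R).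

Definition is_lie_bracket br : Prop :=
  [/\ forall a x x' y, br (a *: x + x') y = a *: br x y + br x' y,
      forall a x y y', br x (a *: y + y') = a *: br x y + br x y',
      forall x, br x x = 0 &
      forall x y t, br x (br y t) + br y (br t x) + br t (br x y) = 0].

Definition two_step_nilpotent br : Prop :=
  (exists x y, br x y != 0) /\ (forall x y t, br x (br y t) = 0).

Definition is_inner_product ip : Prop :=
  [/\ forall a x x' y, ip (a *: x + x') y = a * ip x y + ip x' y,
      forall x y, ip x y = ip y x &
      forall x, (forall y, ip x y = 0) -> x = 0].

Definition lie_center br : set 'rV[R]_n := [set t | forall y, br t y = 0].

Definition orthogonal_to ip (A : set 'rV[R]_n) : set 'rV[R]_n :=
  [set x | forall t, A t -> ip x t = 0].

Definition nondegenerate_on ip (A : set 'rV[R]_n) : Prop :=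
  forall t, A t -> (forall t', A t' -> ip t t' = 0) -> t = 0.

Definition center_compl br ip : set 'rV[R]_n := orthogonal_to ip (lie_center br).

Definition nonnull ip (x : 'rV[R]_n) : Prop := ip x x != 0.

Definition ip_norm ip (x : 'rV[R]_n) : R := Num.sqrt `|ip x x|.

(* J_t x is the element w of v with <w, y> = <t, [x, y]> for all y in v; it
   exists and is unique for x in v when the center is nondegenerate. *)
Definition Jop br ip (t x : 'rV[R]_n) : 'rV[R]_n :=
  xget 0 [set w | center_compl br ip w /\
                  forall y, center_compl br ip y -> ip w y = ip t (br x y)].

Definition pseudoregular br ip : Prop :=
  (forall x, center_compl br ip x -> nonnull ip x ->
     set_surj setT (lie_center br) (br x)) /\
  (forall t, lie_center br t -> nonnull ip t ->
     set_bij (center_compl br ip) (center_compl br ip) (Jop br ip t)).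

Definition pseudoH_type br ip : Prop :=
  forall t x, lie_center br t -> center_compl br ip x ->
    Jop br ip t (Jop br ip t x) = - ip t t *: x.

Definition homothetic_to_pseudoH_type br ip : Prop :=
  exists2 c : R, c != 0 & pseudoH_type br (fun x y => c * ip x y).

Definition grp_mul br (p q : 'rV[R]_n) : 'rV[R]_n := p + q + 2^-1 *: br p q.

Definition grp_inv (p : 'rV[R]_n) : 'rV[R]_n := - p.

Definition left_invariant_metric br ip (p u w : 'rV[R]_n) : R :=
  ip ('D_u (grp_mul br (grp_inv p)) p) ('D_w (grp_mul br (grp_inv p)) p).

End Algebra.

Section Calculus.
Context {R : realType}.

(* f is of class C^k on the open set U. *)
Fixpoint Ck_on {m n : nat} (k : nat) (U : set 'rV[R]_m)
    (f : 'rV[R]_m -> 'rV[R]_n) : Prop :=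
  match k with
  | 0%N => forall x, U x -> {for x, continuous f}
  | k'.+1 => (forall x, U x -> differentiable f x) /\
             (forall v, Ck_on k' U (fun x => 'D_v f x))
  end.

Definition smooth_on {m n : nat} (U : set 'rV[R]_m)
    (f : 'rV[R]_m -> 'rV[R]_n) : Prop := forall k, Ck_on k U f.

End Calculus.

(* Pseudoriemannian geometry of a metric tensor g in one global chart;
   [g p u w] is the product of the tangent vectors u, w at the point p. *)
Section Geometry.
Context {R : realType} {n : nat}.
Implicit Types (g : 'rV[R]_n -> 'rV[R]_n -> 'rV[R]_n -> R).
Implicit Types (V W : 'rV[R]_n -> 'rV[R]_n) (H : set 'rV[R]_n).

Definition basis_vec (i : 'I_n) : 'rV[R]_n := delta_mx 0 i.

Definition gram g (p : 'rV[R]_n) : 'M[R]_n :=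
  \matrix_(i, j) g p (basis_vec i) (basis_vec j).

(* The row of Christoffel symbols of the first kind contracted with u and w:
   entry l is 1/2 (d_u g(w, e_l) + d_w g(u, e_l) - d_l g(u, w)). *)
Definition christoffel1 g (p u w : 'rV[R]_n) : 'rV[R]_n :=
  \row_l (2^-1 * ('D_u (fun q => g q w (basis_vec l)) p
                  + 'D_w (fun q => g q u (basis_vec l)) p
                  - 'D_(basis_vec l) (fun q => g q u w) p)).

Definition christoffel g (p u w : 'rV[R]_n) : 'rV[R]_n :=
  christoffel1 g p u w *m invmx (gram g p).

Definition levi_civita g V W (p : 'rV[R]_n) : 'rV[R]_n :=
  'D_(V p) W p + christoffel g p (V p) (W p).

(* gamma is a geodesic defined on the open interval I; its values off I are
   irrelevant. *)
Definition is_geodesic g (I : set R) (gamma : R -> 'rV[R]_n) : Prop :=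
  [/\ open I, is_interval I &
      forall t, I t ->
        [/\ derivable gamma t 1, derivable (derive1 gamma) t 1 &
            derive1 (derive1 gamma) t
            + christoffel g (gamma t) (derive1 gamma t) (derive1 gamma t) = 0]].

(* Embedded k-dimensional submanifolds, by slice charts: Phi is a
   diffeomorphism of U onto the open set Phi @` U, with inverse Psi, taking
   U `&` H to the points of Phi @` U whose coordinates of index >= k vanish. *)
Definition is_submanifold (k : nat) H : Prop :=
  (k <= n)%N /\
  forall p, H p ->
    exists U : set 'rV[R]_n, exists Phi Psi : 'rV[R]_n -> 'rV[R]_n,
      [/\ open U /\ U p,
          open (Phi @` U),
          smooth_on U Phi /\ smooth_on (Phi @` U) Psi,
          forall q, U q -> Psi (Phi q) = q &
          forall q, U q ->
            (H q <-> forall j : 'I_n, (k <= j)%N -> Phi q 0 j = 0)].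

(* Tangent vectors are the velocities at p of curves lying in H. *)
Definition tangent H (p : 'rV[R]_n) : set 'rV[R]_n :=
  [set v | exists c : R -> 'rV[R]_n,
     [/\ c 0 = p, is_derive (0 : R) (1 : R) c v & \forall t \near (0 : R), H (c t)]].

Definition tangent_field H (U : set 'rV[R]_n) V : Prop :=
  smooth_on U V /\ forall q, U q -> H q -> tangent H q (V q).

(* A vector field on H extends, near each point of H, to a vector field on an
   open subset U of the ambient space, so the latter are quantified over.  The
   metric induced on H may be degenerate. *)
Definition totally_geodesic g H : Prop :=
  forall (U : set 'rV[R]_n) V W, open U ->
    tangent_field H U V -> tangent_field H U W ->
    forall q, U q -> H q -> tangent H q (levi_civita g V W q).

End Geometry.

(* Main.v *)
Require Import Defs.
From HB Require Import structures.
From mathcomp Require Import all_boot all_order all_algebra.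
From mathcomp Require Import all_classical all_reals all_analysis.
From mathcomp Require Import ring lra.

Set Implicit Arguments.
Unset Strict Implicit.
Unset Printing Implicit Defensive.

Import Order.TTheory GRing.Theory Num.Theory.
Import numFieldNormedType.Exports.

Local Open Scope classical_set_scope.
Local Open Scope ring_scope.

(** Write J_z for the operators of the context. The covariant derivative of
    left-invariant fields is algebraic in the bracket and J, and so are the
    curvature and its covariant derivative: 4 R(z,x)z' = J_z J_z' x,
    4 R(z,x)y = [x, J_z y] and 2 (nabla_x R)(z,x)x = - J_[x, J_z x] x.

    (i) => (ii): geodesics with any initial velocity z + x exist, since in the left
    trivialization the velocity is z + exp(t J_z) x.  The tangent space h at 1 of
    a totally geodesic H is stable under R and nabla R.  Being 3-dimensional and
    containing a nonnull central vector, h then contains z and x; its remaining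
    direction is too small for [x, J_z x], J_z J_w x (w = [x, J_z x]) and J_z^2 x
    to be independent of z and x, whence [x, J_z x] is a multiple of z and J_z^2 x a
    multiple of x for generic z and x.  Self-adjointness turns both into scalars,
    and comparing them gives J_z^2 = - c <z,z>.

    (ii) => (i): H is a linear subspace, the span of z and of a J_z-stable plane of v
    containing x whose bracket lies on the line of z.  When x is an eigenvector of
    J_z the plane is completed by an eigenvector for the opposite eigenvalue. *)

(** * Calculus on row vectors *)

(** Condition (i) speaks only of given geodesics, so it yields nothing until a geodesic with initial
    velocity z + x has been constructed; an interval around 0 is enough. Its conclusion supplies
    some nonnull central z' in h, not z itself, and the metric on h may be degenerate. The argument
    therefore avoids orthogonal complements inside h: it counts dimensions and reads linear
    independence off the splitting of n into center and v. From z and x, R gives J_z^2 x and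
    [x, J_z x]; nabla R is what brings in J_z x.

    Indefiniteness also prevents diagonalizing self-adjoint operators. An operator is shown to be
    scalar by comparing the eigenvalues of two eigenvectors that are not orthogonal, and identities
    reach the remaining vectors because a polynomial that vanishes wherever a nonzero polynomial
    does not is zero.

    The left trivialization turns the Levi-Civita connection into a derivative plus a constant
    bilinear term, so that stability of h is a computation with fields tangent along H in which all
    derivatives cancel. *)

Definition bilin {R : realType} {U V W : lmodType R} (b : U -> V -> W) : Prop :=
  (forall a x x' y, b (a *: x + x') y = a *: b x y + b x' y) /\
  (forall a x y y', b x (a *: y + y') = a *: b x y + b x y').

Section Bilinear.
Context {R : realType} {U V W : lmodType R} (b : U -> V -> W).
Hypothesis bb : bilin b.

Lemma bilinDl x x' y : b (x + x') y = b x y + b x' y.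
Proof. by have := bb.1 1 x x' y; rewrite !scale1r. Qed.

Lemma bilinDr x y y' : b x (y + y') = b x y + b x y'.
Proof. by have := bb.2 1 x y y'; rewrite !scale1r. Qed.

Lemma bilin0l y : b 0 y = 0.
Proof. by apply: (addrI (b 0 y)); rewrite -bilinDl !addr0. Qed.

Lemma bilin0r x : b x 0 = 0.
Proof. by apply: (addrI (b x 0)); rewrite -bilinDr !addr0. Qed.

Lemma bilinZl a x y : b (a *: x) y = a *: b x y.
Proof. by rewrite -[a *: x]addr0 bb.1 bilin0l addr0. Qed.

Lemma bilinZr a x y : b x (a *: y) = a *: b x y.
Proof. by rewrite -[a *: y]addr0 bb.2 bilin0r addr0. Qed.

Lemma bilinNl x y : b (- x) y = - b x y.
Proof. by rewrite -scaleN1r bilinZl scaleN1r. Qed.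

Lemma bilinNr x y : b x (- y) = - b x y.
Proof. by rewrite -scaleN1r bilinZr scaleN1r. Qed.

Lemma bilinBl x x' y : b (x - x') y = b x y - b x' y.
Proof. by rewrite bilinDl bilinNl. Qed.

Lemma bilinBr x y y' : b x (y - y') = b x y - b x y'.
Proof. by rewrite bilinDr bilinNr. Qed.

Lemma bilin_suml I (r : seq I) (F : I -> U) y :
  b (\sum_(i <- r) F i) y = \sum_(i <- r) b (F i) y.
Proof.
elim: r => [|i r IH]; first by rewrite !big_nil bilin0l.
by rewrite !big_cons bilinDl IH.
Qed.

Lemma bilin_sumr I (r : seq I) x (F : I -> V) :
  b x (\sum_(i <- r) F i) = \sum_(i <- r) b x (F i).
Proof.
elim: r => [|i r IH]; first by rewrite !big_nil bilin0r.
by rewrite !big_cons bilinDr IH.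
Qed.

End Bilinear.

Section Coordinates.
Context {R : realType}.

Lemma row_sum_basis {m : nat} (x : 'rV[R]_m) :
  x = \sum_(i < m) x 0 i *: basis_vec i.
Proof. by rewrite {1}[x]row_sum_delta. Qed.

Lemma bilin_basis {m p : nat} {W : lmodType R}
    (b : 'rV[R]_m -> 'rV[R]_p -> W) x y : bilin b ->
  b x y = \sum_(i < m) \sum_(j < p) (x 0 i * y 0 j) *: b (basis_vec i) (basis_vec j).
Proof.
move=> bb; rewrite {1}[x]row_sum_basis {1}[y]row_sum_basis bilin_suml//.
apply: eq_bigr => i _; rewrite bilinZl// bilin_sumr// scaler_sumr.
by apply: eq_bigr => j _; rewrite bilinZr// scalerA.
Qed.

End Coordinates.

Section Derivatives.
Context {R : realType} {V W : normedModType R}.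

Lemma is_derive_scalel (k : V -> R) dk (w : W) x v :
  is_derive x v k dk -> is_derive x v (fun z => k z *: w) (dk *: w).
Proof.
move=> [kv <-].
have cv : (fun h => h^-1 *: (((fun z => k z *: w) \o shift x) (h *: v)
             - k x *: w)) @ 0^' --> 'D_v k x *: w.
  rewrite (_ : (fun _ => _) =
    (fun h => (h^-1 *: ((k \o shift x) (h *: v) - k x)) *: w)); last first.
    by apply/funext => h /=; rewrite -scalerBl scalerA.
  by apply: cvgZr_tmp.
by split; [apply/cvg_ex; eexists; exact: cv|exact: cvg_lim cv].
Qed.

Lemma is_derive_mx {m n : nat} (M : V -> 'M[R]_(m, n)) dM x v :
  is_derive x v M dM <-> forall i j, is_derive x v (fun z => M z i j) (dM i j).
Proof.
split=> [[Mv <-] i j|Mv].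
  by split; [exact: (derivable_mxP _ _ _).1 Mv i j|rewrite derive_mx// mxE].
have Md : derivable M x v by apply/derivable_mxP => i j; have [] := Mv i j.
split=> //; rewrite derive_mx//; apply/matrixP => i j; rewrite mxE.
by have [] := Mv i j.
Qed.

Lemma is_derive_fsum n (h : 'I_n -> V -> W) x v (dh : 'I_n -> W) :
  (forall i, is_derive x v (h i) (dh i)) ->
  is_derive x v (fun z => \sum_(i < n) h i z) (\sum_(i < n) dh i).
Proof.
move=> hi; have := is_derive_sum hi.
by rewrite (_ : \sum_(i < n) h i = fun z => \sum_(i < n) h i z)//;
  apply/funext => z; rewrite fct_sumE.
Qed.

(** Expansion in the basis reduces the product rule to scalar functions. It serves the bracket, the
    inner product, [adj] and [conn] alike. *)
Lemma is_derive_bilin {m p : nat} (b : 'rV[R]_m -> 'rV[R]_p -> W)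
    (f : V -> 'rV[R]_m) (g : V -> 'rV[R]_p) df dg x v :
  bilin b -> is_derive x v f df -> is_derive x v g dg ->
  is_derive x v (fun z => b (f z) (g z)) (b df (g x) + b (f x) dg).
Proof.
move=> bb /is_derive_mx fd /is_derive_mx gd.
rewrite (_ : (fun _ => _) = (fun z => \sum_(i < m) \sum_(j < p)
   (f z 0 i * g z 0 j) *: b (basis_vec i) (basis_vec j))); last first.
  by apply/funext => z; exact: bilin_basis.
rewrite [b df _]bilin_basis// [b _ dg]bilin_basis// -big_split/=.
apply: is_derive_fsum => i; rewrite -big_split/=.
apply: is_derive_fsum => j; rewrite -scalerDl.
have := @is_deriveM _ _ _ _ _ _ _ _ (fd 0 i) (gd 0 j).
move=> /(is_derive_scalel (b (basis_vec i) (basis_vec j))).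
by move=> H; apply: is_derive_eq H _; rewrite addrC; congr (_ *: _); rewrite /GRing.scale /=; ring.
Qed.

End Derivatives.

Section Differentiability.
Context {R : realType} {V : normedModType R}.

Lemma derive_chain {W W' : normedModType R} (f : V -> W) (g : W -> W') x v :
  differentiable f x -> differentiable g (f x) ->
  'D_v (g \o f) x = 'D_('D_v f x) g (f x).
Proof.
move=> df dg; rewrite !deriveE//; last exact: differentiable_comp.
by rewrite diff_comp.
Qed.

Lemma is_derive_chain {W W' : normedModType R} (f : V -> W) (g : W -> W') df x v :
  differentiable f x -> is_derive x v f df -> differentiable g (f x) ->
  is_derive x v (g \o f) ('D_df g (f x)).
Proof.
move=> fd [_ <-] gd; split; last by rewrite derive_chain.
exact/diff_derivable/differentiable_comp.
Qed.

Lemma deriveDdir {W : normedModType R} (f : V -> W) x u v :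
  differentiable f x -> 'D_(u + v) f x = 'D_u f x + 'D_v f x.
Proof. by move=> fd; rewrite !deriveE// linearD. Qed.

Lemma deriveZdir {W : normedModType R} (f : V -> W) x (a : R) v :
  differentiable f x -> 'D_(a *: v) f x = a *: 'D_v f x.
Proof. by move=> fd; rewrite !deriveE// linearZ. Qed.

Lemma differentiable_fsum {W : normedModType R} n (f : 'I_n -> V -> W) x :
  (forall i, differentiable (f i) x) ->
  differentiable (fun z => \sum_(i < n) f i z) x.
Proof.
move=> /differentiable_sum; rewrite (_ : \sum_(i < n) f i = fun z => \sum_(i < n) f i z)//.
by apply/funext => z; rewrite fct_sumE.
Qed.

Lemma differentiable_coords {m : nat} (f : V -> 'rV[R]_m) x i :
  differentiable f x -> differentiable (fun z => f z 0 i) x.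
Proof.
move=> fd; exact: (differentiable_comp fd (differentiable_coord (f x) 0 i)).
Qed.

Lemma differentiable_bilin_fun {m p : nat} {W : normedModType R}
    (b : 'rV[R]_m -> 'rV[R]_p -> W) (f : V -> 'rV[R]_m) (g : V -> 'rV[R]_p) x :
  bilin b -> differentiable f x -> differentiable g x ->
  differentiable (fun z => b (f z) (g z)) x.
Proof.
move=> bb fd gd.
rewrite (_ : (fun _ => _) = (fun z => \sum_(i < m) \sum_(j < p)
   (f z 0 i * g z 0 j) *: b (basis_vec i) (basis_vec j))); last first.
  by apply/funext => z; exact: bilin_basis.
apply: differentiable_fsum => i; apply: differentiable_fsum => j.
apply: differentiableZl.
exact: (differentiableM (differentiable_coords i fd) (differentiable_coords j gd)).
Qed.

Lemma derive_bilin_fun {m p : nat} {W : normedModType R}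
    (b : 'rV[R]_m -> 'rV[R]_p -> W) (f : V -> 'rV[R]_m) (g : V -> 'rV[R]_p) x v :
  bilin b -> differentiable f x -> differentiable g x ->
  'D_v (fun z => b (f z) (g z)) x = b ('D_v f x) (g x) + b (f x) ('D_v g x).
Proof.
move=> bb fd gd.
by have [] := is_derive_bilin bb (derivableP (@diff_derivable _ _ _ _ _ v fd))
  (derivableP (@diff_derivable _ _ _ _ _ v gd)).
Qed.

Lemma differentiable_mulmx {m n : nat} (f : V -> 'rV[R]_m) (A : 'M[R]_(m, n)) x :
  differentiable f x -> differentiable (fun z => f z *m A) x.
Proof.
move=> fd; rewrite (_ : (fun _ => _) = fun z => \sum_(i < m) f z 0 i *: row i A).
  apply: differentiable_fsum => i; apply: differentiableZl.
  exact: differentiable_coords.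
by apply/funext => z; rewrite mulmx_sum_row.
Qed.

Lemma is_derive_mulmx {m n : nat} (f : V -> 'rV[R]_m) (A : 'M[R]_(m, n)) x v df :
  is_derive x v f df -> is_derive x v (fun z => f z *m A) (df *m A).
Proof.
move=> /is_derive_mx fd.
rewrite (_ : (fun _ => _) = fun z => \sum_(i < m) f z 0 i *: row i A).
  rewrite mulmx_sum_row; apply: is_derive_fsum => i.
  exact: is_derive_scalel (fd 0 i).
by apply/funext => z; rewrite mulmx_sum_row.
Qed.

Lemma derive_mulmx {m n : nat} (f : V -> 'rV[R]_m) (A : 'M[R]_(m, n)) x v :
  differentiable f x -> 'D_v (fun z => f z *m A) x = 'D_v f x *m A.
Proof.
move=> fd; by have [] := is_derive_mulmx A (derivableP (@diff_derivable _ _ _ _ _ v fd)).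
Qed.

(** The differential of g is not known in advance: ['d f x] satisfies the expansion required of it,
    and uniqueness of the differential identifies the two. *)
Lemma near_eq_differentiable {W : normedModType R} (f g : V -> W) x :
  (\near x, f x = g x) -> differentiable f x -> differentiable g x.
Proof.
move=> fg fd.
have E : g \o shift x = cst (g x) + 'd f x +o_ 0 id.
  apply/eqaddoP => _/posnumP[e].
  have /eqaddoP/(_ _ (gt0 e)) := diff_locally fd.
  have fgx : \forall z \near 0, f (z + x) = g (z + x).
    by move: fg; rewrite (near_shift 0) subr0.
  apply: filter_app; apply: filter_app fgx; apply: nearW => z /= fgz.
  by rewrite !fctE /= fgz (nbhs_singleton fg).
apply/diff_locallyP.
have dE := diff_unique (diff_continuous fd) E.
by rewrite dE; split=> //; exact: diff_continuous.
Qed.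

End Differentiability.

Lemma near_eq_continuous {T T' : topologicalType} (f g : T -> T') x :
  (\near x, f x = g x) -> {for x, continuous f} -> {for x, continuous g}.
Proof.
move=> fg fc; rewrite /prop_for /continuous_at -(nbhs_singleton fg).
by apply: cvg_trans fc; apply: near_eq_cvg; apply: filterS fg => z ->.
Qed.

(** * Functions of class C^k *)

Section CkCalculus.
Context {R : realType}.

Lemma open_near {m : nat} (U : set 'rV[R]_m) x : open U -> U x -> \near x, U x.
Proof. by move=> oU Ux; apply: open_nbhs_nbhs; split. Qed.

Lemma bilin_continuous {m p q : nat} (b : 'rV[R]_m -> 'rV[R]_p -> 'rV[R]_q)
    (T : topologicalType) (f : T -> 'rV[R]_m) (g : T -> 'rV[R]_p) x :
  bilin b -> {for x, continuous f} -> {for x, continuous g} ->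
  {for x, continuous (fun z => b (f z) (g z))}.
Proof.
move=> bb fc gc.
have d1 (z : 'rV[R]_m * 'rV[R]_p) : differentiable (fun w => w.1 : 'rV[R]_m) z.
  by apply: (@linear_differentiable _ _ _ fst) => ?; exact: cvg_fst.
have d2 (z : 'rV[R]_m * 'rV[R]_p) : differentiable (fun w => w.2 : 'rV[R]_p) z.
  by apply: (@linear_differentiable _ _ _ snd) => ?; exact: cvg_snd.
have bc := differentiable_continuous (differentiable_bilin_fun bb (d1 (f x, g x)) (d2 _)).
exact: (@continuous_comp _ _ _ (fun z => (f z, g z)) (fun w => b w.1 w.2) _
  (cvg_pair fc gc) bc).
Qed.

Lemma Ck_on_ext {m n : nat} k (U : set 'rV[R]_m) (f g : 'rV[R]_m -> 'rV[R]_n) :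
  open U -> (forall x, U x -> f x = g x) -> Ck_on k U f -> Ck_on k U g.
Proof.
move=> oU; elim: k f g => [|k IH] f g fg /= => [fc x Ux|[fd fk]].
  have nfg : \near x, f x = g x.
    by apply: filterS (open_near oU Ux) => z /fg.
  exact: near_eq_continuous nfg (fc x Ux).
split=> [x Ux|v].
  apply: near_eq_differentiable (fd x Ux).
  by apply: filterS (open_near oU Ux) => z /fg.
apply: IH (fk v) => x Ux /=; apply: near_eq_derive.
by apply: filterS (open_near oU Ux) => z /fg.
Qed.

Lemma Ck_onS {m n : nat} k (U : set 'rV[R]_m) (f : 'rV[R]_m -> 'rV[R]_n) :
  Ck_on k.+1 U f -> Ck_on k U f.
Proof.
elim: k f => [|k IH] f [fd fk].
  by move=> x Ux; exact: differentiable_continuous (fd x Ux).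
by split=> // v; exact: IH (fk v).
Qed.

Lemma Ck_on_cst {m n : nat} k (U : set 'rV[R]_m) (c : 'rV[R]_n) :
  Ck_on k U (fun=> c).
Proof.
elim: k c => [|k IH] c; first by move=> x _; exact: cst_continuous.
split=> [x _|v]; first exact: differentiable_cst.
have -> : 'D_v (fun=> c : 'rV[R]_n) = (fun _ : 'rV[R]_m => (0 : 'rV[R]_n)).
  by apply/funext => x; rewrite derive_cst.
exact: IH.
Qed.

Lemma Ck_on_id {m : nat} k (U : set 'rV[R]_m) : Ck_on k U id.
Proof.
case: k => [|k]; first by move=> x _ A.
split=> [x _|v]; first exact: ex_diff.
have -> : 'D_v (id : 'rV[R]_m -> 'rV[R]_m) = fun=> v.
  by apply/funext => x; rewrite derive_id.
exact: Ck_on_cst.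
Qed.

Lemma Ck_on_add {m n : nat} k (U : set 'rV[R]_m) (f g : 'rV[R]_m -> 'rV[R]_n) :
  open U -> Ck_on k U f -> Ck_on k U g -> Ck_on k U (fun x => f x + g x).
Proof.
move=> oU; elim: k f g => [|k IH] f g /=.
  by move=> fc gc x Ux; apply: continuousD; [exact: fc|exact: gc].
move=> [fd fk] [gd gk]; split=> [x Ux|v].
  by apply: differentiableD; [exact: fd|exact: gd].
apply: Ck_on_ext (IH _ _ (fk v) (gk v)) => // x Ux.
have fx := @diff_derivable _ _ _ _ _ v (fd x Ux).
have gx := @diff_derivable _ _ _ _ _ v (gd x Ux).
by rewrite -(deriveD fx gx).
Qed.

Lemma Ck_on_bilin {m p q r : nat} k (U : set 'rV[R]_m)
    (b : 'rV[R]_p -> 'rV[R]_q -> 'rV[R]_r) f g :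
  open U -> bilin b -> Ck_on k U f -> Ck_on k U g ->
  Ck_on k U (fun x => b (f x) (g x)).
Proof.
move=> oU bb; elim: k f g => [|k IH] f g.
  by move=> fc gc x Ux; apply: bilin_continuous; [|exact: fc|exact: gc].
move=> fk1 gk1; have [fd fk] := fk1; have [gd gk] := gk1.
split=> [x Ux|v].
  by apply: differentiable_bilin_fun; [|exact: fd|exact: gd].
apply: (@Ck_on_ext _ _ _ _
  (fun x => b ('D_v f x) (g x) + b (f x) ('D_v g x))) => // [x Ux|].
  by rewrite derive_bilin_fun//; [exact: fd|exact: gd].
apply: Ck_on_add => //.
  exact: IH (fk v) (Ck_onS gk1).
exact: IH (Ck_onS fk1) (gk v).
Qed.

Lemma Ck_on_sum {m n p : nat} k (U : set 'rV[R]_m) (f : 'I_p -> 'rV[R]_m -> 'rV[R]_n) :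
  open U -> (forall i, Ck_on k U (f i)) -> Ck_on k U (fun x => \sum_i f i x).
Proof.
move=> oU fk.
suff H (s : seq 'I_p) : Ck_on k U (fun x => \sum_(i <- s) f i x) by exact: H.
elim: s => [|i s IH].
  by under eq_fun do rewrite big_nil; exact: Ck_on_cst.
by under eq_fun do rewrite big_cons; exact: Ck_on_add.
Qed.

Lemma bilin_coord {m n : nat} (i : 'I_m) :
  bilin (fun (u : 'rV[R]_m) (w : 'rV[R]_n) => u 0 i *: w).
Proof.
split=> a x *; first by rewrite !mxE scalerDl scalerA.
by rewrite scalerDr !scalerA mulrC.
Qed.

Lemma derive_basis {m n : nat} (f : 'rV[R]_m -> 'rV[R]_n) x v :
  differentiable f x -> 'D_v f x = \sum_i v 0 i *: 'D_(basis_vec i) f x.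
Proof.
move=> fd; rewrite deriveE// {1}[v]row_sum_basis linear_sum.
by apply: eq_bigr => i _; rewrite linearZ deriveE.
Qed.

(** [Ck_on] controls derivatives in fixed directions only; expanding V in the basis turns the moving
    direction into coefficients of class C^k. *)
Lemma Ck_on_dir {m n : nat} k (U : set 'rV[R]_m) (V : 'rV[R]_m -> 'rV[R]_m)
    (f : 'rV[R]_m -> 'rV[R]_n) :
  open U -> Ck_on k U V -> Ck_on k.+1 U f -> Ck_on k U (fun x => 'D_(V x) f x).
Proof.
move=> oU Vk [fd fk].
apply: (@Ck_on_ext _ _ _ _
  (fun x => \sum_i (V x) 0 i *: 'D_(basis_vec i) f x)) => // [x Ux|].
  by rewrite -derive_basis//; exact: fd.
apply: Ck_on_sum => // i.
exact: (Ck_on_bilin oU (bilin_coord i) Vk (fk _)).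
Qed.

Lemma Ck_on_comp {m n p : nat} k (U : set 'rV[R]_m) (U' : set 'rV[R]_n)
    (f : 'rV[R]_m -> 'rV[R]_n) (g : 'rV[R]_n -> 'rV[R]_p) :
  open U -> (forall x, U x -> U' (f x)) -> Ck_on k U f -> Ck_on k U' g ->
  Ck_on k U (g \o f).
Proof.
move=> oU fU; elim: k g => [|k IH] g.
  move=> fc gc x Ux; apply: continuous_comp; first exact: fc.
  exact: gc (fU _ Ux).
move=> fk1 gk1; have [fd fk] := fk1; have [gd gk] := gk1.
split=> [x Ux|v].
  by apply: differentiable_comp; [exact: fd|exact: gd (fU _ Ux)].
apply: (@Ck_on_ext _ _ _ _ (fun x => \sum_i ('D_v f x) 0 i *:
    ((fun y => 'D_(basis_vec i) g y) \o f) x)) => // [x Ux|].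
  have gfx := gd _ (fU _ Ux).
  by rewrite (derive_chain v (fd x Ux) gfx) [RHS]derive_basis.
apply: Ck_on_sum => // i; apply: (Ck_on_bilin oU (bilin_coord i) (fk v)).
exact: IH (Ck_onS fk1) (gk _).
Qed.

Lemma smooth_on_differentiable {m n : nat} (U : set 'rV[R]_m)
    (f : 'rV[R]_m -> 'rV[R]_n) x : smooth_on U f -> U x -> differentiable f x.
Proof. by move=> /(_ 1%N)[fd _] Ux; exact: fd Ux. Qed.

Lemma smooth_on_mulmx {m n p : nat} (U : set 'rV[R]_m)
    (f : 'rV[R]_m -> 'rV[R]_n) (A : 'M[R]_(n, p)) :
  open U -> smooth_on U f -> smooth_on U (fun x => f x *m A).
Proof.
move=> oU fs k; elim: k f fs => [|k IH] f fs.
  move=> x Ux; apply: differentiable_continuous; apply: differentiable_mulmx.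
  exact: smooth_on_differentiable Ux.
split=> [x Ux|v].
  apply: differentiable_mulmx; exact: smooth_on_differentiable Ux.
apply: (@Ck_on_ext _ _ _ _ (fun x => 'D_v f x *m A)) => // [x Ux|].
  by rewrite derive_mulmx//; exact: smooth_on_differentiable Ux.
by apply: IH => j; have [_] := fs j.+1; exact.
Qed.

End CkCalculus.

(** * Symmetry of second derivatives *)

Section Schwarz.
Context {R : realType} {V : normedModType R}.
Implicit Types (F : V -> R) (u v x : V).

Lemma is_derive_line F x u (s : R) : differentiable F (x + s *: u) ->
  is_derive s (1 : R) (fun r : R => F (x + r *: u)) ('D_u F (x + s *: u)).
Proof.
move=> Fd.
have l : is_derive s (1 : R) (fun r : R => x + r *: u) u.
  have := @is_derive_scalel R R V id 1 u s 1 _.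
  move=> /(_ (is_derive_id _ _)) l.
  apply: is_derive_eq (is_deriveD (is_derive_cst x s 1) l) _.
  by rewrite add0r scale1r.
by apply: is_derive_chain => //; apply/derivable1_diffP; case: l.
Qed.

Lemma MVT_line F x u (t : R) : 0 < t ->
  (forall s, 0 <= s <= t -> differentiable F (x + s *: u)) ->
  exists2 s, 0 <= s <= t & F (x + t *: u) - F x = t * 'D_u F (x + s *: u).
Proof.
move=> t0 Fd.
have [|s|s /itvP si E] := @MVT_segment R (fun r : R => F (x + r *: u))
  (fun r => 'D_u F (x + r *: u)) 0 t (ltW t0).
- by move=> r /itvP ri; apply: is_derive_line; apply: Fd; rewrite !ri.
- apply: derivable_within_continuous => r; rewrite in_itv /= => ri.
  by have [] := is_derive_line (Fd r ri).
- exists s; first by rewrite !si.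
  by rewrite -[in F x](addr0 x) -(scale0r u) E subr0 mulrC.
Qed.

(** The mean value theorem is used twice: along u for the increment of F by t v, then along v for
    ['D_u F]. *)
Lemma MVT_square F x u v (t : R) : 0 < t ->
  (forall s r, 0 <= s <= t -> 0 <= r <= t ->
     differentiable F (x + s *: u + r *: v) /\
     differentiable ('D_u F) (x + s *: u + r *: v)) ->
  exists s r, [/\ 0 <= s <= t, 0 <= r <= t &
    F (x + t *: u + t *: v) - F (x + t *: u) - F (x + t *: v) + F x
    = t * (t * 'D_v ('D_u F) (x + s *: u + r *: v))].
Proof.
move=> t0 Fd.
have tt : 0 <= t <= t by rewrite lexx ltW.
have t00 : 0 <= (0 : R) <= t by rewrite lexx ltW.
pose G y := F (y + t *: v) - F y.
have Gd s : 0 <= s <= t -> is_derive (x + s *: u) u G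
    ('D_u F (x + s *: u + t *: v) - 'D_u F (x + s *: u)) /\
    differentiable G (x + s *: u).
  move=> si; have [d1 _] := Fd s t si tt.
  have [] := Fd s 0 si t00; rewrite scale0r addr0 => d2 _.
  have sh : differentiable (fun y : V => y + t *: v) (x + s *: u).
    exact: differentiableD.
  have d3 : differentiable (fun y => F (y + t *: v)) (x + s *: u).
    exact: (differentiable_comp sh).
  split; last exact: differentiableB.
  apply: is_deriveB; last exact/derivableP/diff_derivable.
  have i1 : is_derive (x + s *: u) u (fun y : V => y + t *: v) u.
    apply: is_derive_eq (is_deriveD (is_derive_id _ _) (is_derive_cst _ _ _)) _.
    by rewrite addr0.
  exact: (is_derive_chain sh i1).
have [|s si GE] := @MVT_line G x u t t0; first by move=> s /Gd[].
have [[_ GD] _] := Gd s si; rewrite GD in GE.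
have [r ri E] := @MVT_line ('D_u F) (x + s *: u) v t t0
  (fun r ri => (Fd s r si ri).2).
exists s, r; split=> //; rewrite -E -GE /G.
by rewrite opprB addrA addrAC.
Qed.

Lemma near_square x u v (P : set V) : (\near x, P x) ->
  exists2 t : R, 0 < t & forall s r, 0 <= s <= t -> 0 <= r <= t ->
    P (x + s *: u + r *: v).
Proof.
move=> /nbhs_normP[e /= e0 eP].
have K0 : 0 < `|u| + `|v| + 1 by rewrite ltr_pwDr// addr_ge0.
exists (e / (`|u| + `|v| + 1)); first exact: divr_gt0.
move=> s r /andP[s0 st] /andP[r0 rt]; apply: eP.
rewrite /ball_/= -addrA opprD addrA subrr sub0r normrN.
apply: le_lt_trans (ler_normD _ _) _; rewrite !normrZ !ger0_norm//.
apply: le_lt_trans (_ : e / (`|u| + `|v| + 1) * (`|u| + `|v|) < _).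
  by rewrite mulrDr lerD// ler_wpM2r.
by rewrite mulrAC ltr_pdivrMr// ltr_pM2l// ltrDl.
Qed.

(** The second difference over a square is symmetric in u and v, so the two mixed derivatives take a
    common value, at possibly different points of the square. On a square where each stays within
    half the gap of its value at x, this is a contradiction. *)
Lemma derive_comm F x u v :
  (\near x, [/\ differentiable F x, differentiable ('D_u F) x &
                differentiable ('D_v F) x]) ->
  {for x, continuous ('D_v ('D_u F))} -> {for x, continuous ('D_u ('D_v F))} ->
  'D_v ('D_u F) x = 'D_u ('D_v F) x.
Proof.
move=> Fd c1 c2; apply/eqP; rewrite -subr_eq0; apply/negPn/negP => ne.
set a := _ - _ in ne; have a0 : 0 < `|a| / 2 by rewrite divr_gt0// normr_gt0.
have /cvgrPdist_lt/(_ _ a0) n1 := c1; have /cvgrPdist_lt/(_ _ a0) n2 := c2.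
have [t t0 tP] := near_square u v (filterI Fd (filterI n1 n2)).
have [|s [r [si ri E1]]] := @MVT_square F x u v t t0.
  by move=> s0 r0 si ri; have [[]] := tP s0 r0 si ri.
have [|r' [s' [ri' si' E2]]] := @MVT_square F x v u t t0.
  by move=> r0 s0 ri' si'; rewrite addrAC; have [[]] := tP s0 r0 si' ri'.
have E : t * (t * 'D_v ('D_u F) (x + s *: u + r *: v)) =
         t * (t * 'D_u ('D_v F) (x + r' *: v + s' *: u)).
  apply: etrans (esym E1) (etrans _ E2).
  have -> : x + t *: v + t *: u = x + t *: u + t *: v by exact: addrAC.
  by congr (_ + _); exact: addrAC.
have tn : t != 0 by rewrite gt_eqF.
move/(mulfI tn)/(mulfI tn) : E => E.
have [_ [/= b1 _]] := tP s r si ri.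
have [_ [/= _]] := tP s' r' si' ri'; rewrite addrAC => b2.
have : `|a| < `|a|.
  rewrite [ltRHS]splitr; apply: le_lt_trans (ltrD b1 b2).
  rewrite [X in _ + X]distrC E; apply: le_trans (ler_normD _ _).
  by rewrite addrA subrK.
by rewrite ltxx.
Qed.

End Schwarz.

Lemma Ck_derive_comm {R : realType} {m n : nat} (U : set 'rV[R]_m)
    (f : 'rV[R]_m -> 'rV[R]_n) x u v : open U -> Ck_on 2 U f -> U x ->
  'D_v (fun y => 'D_u f y) x = 'D_u (fun y => 'D_v f y) x.
Proof.
move=> oU [fd f1] Ux; have [ud u1] := f1 u; have [vd v1] := f1 v.
have dE w y : U y -> 'D_w f y = \row_j 'D_w (fun z => f z 0 j) y.
  move=> Uy; rewrite derive_mx; last exact/diff_derivable/fd.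
  by apply/rowP => j; rewrite !mxE.
have cE j w y : U y -> 'D_w (fun z => f z 0 j) y = 'D_w f y 0 j.
  by move=> Uy; rewrite dE// mxE.
have nx P : (forall y, U y -> P y) -> \near x, P x.
  by move=> UP; apply: filterS (open_near oU Ux).
have c2E j w w' y : U y -> (forall z, U z -> differentiable ('D_w f) z) ->
    'D_w' ('D_w (fun z => f z 0 j)) y = 'D_w' ('D_w f) y 0 j.
  move=> Uy wd.
  rewrite (_ : 'D_w' ('D_w (fun z => f z 0 j)) y = 'D_w' (fun z => 'D_w f z 0 j) y).
    rewrite [in RHS]derive_mx; last exact/diff_derivable/wd.
    by rewrite mxE.
  apply: near_eq_derive; apply: filterS (open_near oU Uy) => z Uz.
  by rewrite cE.
apply/rowP => j.
have wd2 w z : U z -> differentiable ('D_w f) z -> 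
    differentiable ('D_w (fun z => f z 0 j)) z.
  move=> Uz d; apply: near_eq_differentiable (differentiable_coords j d).
  by apply: filterS (open_near oU Uz) => y Uy; rewrite cE.
have ctn w w' : (forall z, U z -> differentiable ('D_w f) z) ->
    {for x, continuous ('D_w' ('D_w f))} ->
    {for x, continuous ('D_w' ('D_w (fun z => f z 0 j)))}.
  move=> wd cw.
  have cc : {for x, continuous (fun z => 'D_w' ('D_w f) z 0 j)}.
    exact: (continuous_comp cw (@coord_continuous R 1 n 0 j _)).
  by apply: near_eq_continuous cc; apply: nx => y Uy; rewrite c2E.
apply: etrans (esym (c2E j u v x Ux ud)) (etrans _ (c2E j v u x Ux vd)).
apply: derive_comm.
- apply: nx => y Uy; split; first exact/differentiable_coords/fd.
    exact/wd2/ud.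
  exact/wd2/vd.
- exact: ctn ud (u1 v x Ux).
- exact: ctn vd (v1 u x Ux).
Qed.

(** * The left-invariant connection and its curvature *)

Section MetricAlgebra.
Context {R : realType} {n : nat} (ip : 'rV[R]_n -> 'rV[R]_n -> R).
Hypothesis ip_inner : is_inner_product ip.

Lemma ipC x y : ip x y = ip y x.
Proof. by case: ip_inner => _ + _; apply. Qed.

Lemma ip_bilin : bilin (ip : _ -> _ -> R^o).
Proof.
have [ipl ipS _] := ip_inner; split=> [a x x' y|a x y y']; first exact: ipl.
by rewrite ipC ipl 2!(ipC _ x).
Qed.

Lemma ipDl x x' y : ip (x + x') y = ip x y + ip x' y.
Proof. exact: (bilinDl ip_bilin). Qed.
Lemma ipDr x y y' : ip x (y + y') = ip x y + ip x y'.
Proof. exact: (bilinDr ip_bilin). Qed.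
Lemma ipZl a x y : ip (a *: x) y = a * ip x y.
Proof. exact: (bilinZl ip_bilin). Qed.
Lemma ipZr a x y : ip x (a *: y) = a * ip x y.
Proof. exact: (bilinZr ip_bilin). Qed.
Lemma ipNl x y : ip (- x) y = - ip x y.
Proof. exact: (bilinNl ip_bilin). Qed.
Lemma ipNr x y : ip x (- y) = - ip x y.
Proof. exact: (bilinNr ip_bilin). Qed.
Lemma ip0l x : ip 0 x = 0.
Proof. exact: (bilin0l ip_bilin). Qed.
Lemma ip0r x : ip x 0 = 0.
Proof. exact: (bilin0r ip_bilin). Qed.
Lemma ip_suml I (r : seq I) (F : I -> 'rV[R]_n) y :
  ip (\sum_(i <- r) F i) y = \sum_(i <- r) ip (F i) y.
Proof. exact: (bilin_suml ip_bilin). Qed.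
Lemma ip_sumr I (r : seq I) (F : I -> 'rV[R]_n) y :
  ip y (\sum_(i <- r) F i) = \sum_(i <- r) ip y (F i).
Proof. exact: (bilin_sumr ip_bilin). Qed.

Definition ipE := (ipDl, ipDr, ipZl, ipZr, ipNl, ipNr, ip0l, ip0r).

Lemma ip_nondeg x : (forall y, ip x y = 0) -> x = 0.
Proof. by case: ip_inner => _ _; apply. Qed.

Lemma ip_inj x x' : (forall y, ip x y = ip x' y) -> x = x'.
Proof.
move=> xx'; apply/eqP; rewrite -subr_eq0; apply/eqP/ip_nondeg => y.
by rewrite !ipE xx' subrr.
Qed.

Lemma nonnull_neq0 x : nonnull ip x -> x != 0.
Proof. by apply: contraNneq => ->; rewrite ip0l. Qed.

Definition ip_mx : 'M[R]_n := \matrix_(i, j) ip (basis_vec i) (basis_vec j).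

Lemma mul_ip_mx x : x *m ip_mx = \row_l ip x (basis_vec l).
Proof.
apply/rowP => l; rewrite !mxE {2}[x]row_sum_basis ip_suml.
by apply: eq_bigr => i _; rewrite !mxE ipZl.
Qed.

Lemma ip_mxE x y : (x *m ip_mx *m y^T) 0 0 = ip x y.
Proof.
rewrite mul_ip_mx !mxE {2}[y]row_sum_basis ip_sumr.
by apply: eq_bigr => i _; rewrite !mxE ipZr mulrC.
Qed.

Lemma ip_mx_unit : ip_mx \in unitmx.
Proof.
rewrite -row_free_unit; apply: inj_row_free => x x0; apply: ip_nondeg => y.
by rewrite -ip_mxE x0 mul0mx mxE.
Qed.

Definition riesz (phi : 'rV[R]_n -> R) : 'rV[R]_n :=
  (\row_l phi (basis_vec l)) *m invmx ip_mx.

Lemma ip_riesz (phi : 'rV[R]_n -> R) y :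
  (forall a u w, phi (a *: u + w) = a * phi u + phi w) -> ip (riesz phi) y = phi y.
Proof.
move=> phil; rewrite -ip_mxE mulmxKV ?ip_mx_unit// !mxE.
have phiD u w : phi (u + w) = phi u + phi w.
  by have := phil 1 u w; rewrite scale1r mul1r.
have phi0 : phi 0 = 0 by apply: (addrI (phi 0)); rewrite -phiD !addr0.
rewrite [in RHS](row_sum_basis y) (big_morph phi phiD phi0).
by apply: eq_bigr => i _; rewrite !mxE -[_ *: _]addr0 phil phi0 addr0 mulrC.
Qed.

End MetricAlgebra.

Section TwoStep.
Context {R : realType} {n : nat}.
Context {br : 'rV[R]_n -> 'rV[R]_n -> 'rV[R]_n} {ip : 'rV[R]_n -> 'rV[R]_n -> R}.
Hypothesis br_lie : is_lie_bracket br.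
Hypothesis br_two_step : two_step_nilpotent br.
Hypothesis ip_inner : is_inner_product ip.

Lemma br_bilin : bilin br.
Proof. by case: br_lie => ? ? _ _. Qed.

Lemma brxx x : br x x = 0.
Proof. by case: br_lie => _ _ + _; apply. Qed.

Lemma brC x y : br x y = - br y x.
Proof.
have := brxx (x + y); rewrite (bilinDl br_bilin) !(bilinDr br_bilin) !brxx.
by rewrite add0r addr0 => /eqP; rewrite addr_eq0 => /eqP.
Qed.

Lemma br_center x y : lie_center br (br x y).
Proof. by move=> t; rewrite brC (br_two_step.2 t x y) oppr0. Qed.

Lemma br_centerr t y : lie_center br t -> br y t = 0.
Proof. by move=> tc; rewrite brC tc oppr0. Qed.

Lemma lie_centerP a t t' :
  lie_center br t -> lie_center br t' -> lie_center br (a *: t + t').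
Proof. by move=> tc tc' y; rewrite br_bilin.1 tc tc' scaler0 addr0. Qed.

Lemma lie_centerZ a t : lie_center br t -> lie_center br (a *: t).
Proof. by move=> tc y; rewrite (bilinZl br_bilin) tc scaler0. Qed.

Lemma center_complP a x x' : center_compl br ip x -> center_compl br ip x' ->
  center_compl br ip (a *: x + x').
Proof. by move=> xv xv' t tc; rewrite !ipE// xv// xv'// mulr0 addr0. Qed.

Lemma center_compl0 : center_compl br ip 0.
Proof. by move=> t _; rewrite ip0l. Qed.

Lemma center_complZ a x : center_compl br ip x -> center_compl br ip (a *: x).
Proof. by move=> xv t tc; rewrite !ipE// xv// mulr0. Qed.

(* The extension of (z, x) |-> J_z x to all of n by J_x = 0 on v and J_z z' = 0. *)
Definition adj t x : 'rV[R]_n := riesz ip (fun y => ip t (br x y)).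

Lemma ip_adj t x y : ip (adj t x) y = ip t (br x y).
Proof.
by apply: ip_riesz => // a u w; rewrite br_bilin.2 !ipE.
Qed.

Lemma adj_bilin : bilin adj.
Proof.
by split=> a *; apply: (ip_inj ip_inner) => w; rewrite !ipE// !ip_adj// ?br_bilin.1 !ipE.
Qed.

Lemma adj_skew t x y : ip (adj t x) y = - ip x (adj t y).
Proof. by rewrite [in RHS]ipC// !ip_adj brC ipNr. Qed.

Lemma adj_compl t x : center_compl br ip (adj t x).
Proof. by move=> z zc; rewrite ip_adj br_centerr// ip0r. Qed.

Lemma adj_compl0 x y : center_compl br ip x -> adj x y = 0.
Proof.
move=> xv; apply: (ip_nondeg ip_inner) => w; rewrite ip_adj.
exact: xv (br_center _ _).
Qed.

Lemma adj_center0 t z : lie_center br z -> adj t z = 0.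
Proof. by move=> zc; apply: (ip_nondeg ip_inner) => w; rewrite ip_adj zc ip0r. Qed.

(* The Levi-Civita connection on left-invariant fields (Koszul formula). *)
Definition conn a b : 'rV[R]_n := 2^-1 *: (br a b - adj a b - adj b a).

Lemma conn_bilin : bilin conn.
Proof.
split=> a *; rewrite /conn ?br_bilin.1 ?br_bilin.2 ?adj_bilin.1 ?adj_bilin.2;
  by apply/rowP => i; rewrite !mxE; ring.
Qed.

Lemma conn_torsion a b : conn a b - conn b a = br a b.
Proof. by rewrite /conn [br b a]brC; apply/rowP => i; rewrite !mxE; field. Qed.

Definition curv a b c : 'rV[R]_n :=
  conn a (conn b c) - conn b (conn a c) - conn (br a b) c.

Definition nabla_curv d a b c : 'rV[R]_n :=
  conn d (curv a b c) - curv (conn d a) b c - curv a (conn d b) c - curv a b (conn d c).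

Section Values.
Variables (z z' x y w : 'rV[R]_n).
Hypotheses (zc : lie_center br z) (z'c : lie_center br z').
Hypotheses (xv : center_compl br ip x) (yv : center_compl br ip y).
Hypothesis (wv : center_compl br ip w).

Lemma conn_zz : conn z z' = 0.
Proof. by rewrite /conn zc !adj_center0// !subr0 scaler0. Qed.

Lemma conn_zv : conn z x = - 2^-1 *: adj z x.
Proof.
by rewrite /conn zc (adj_compl0 z xv); apply/rowP => i; rewrite !mxE; ring.
Qed.

Lemma conn_vz : conn x z = - 2^-1 *: adj z x.
Proof.
rewrite /conn br_centerr// (adj_compl0 z xv).
by apply/rowP => i; rewrite !mxE; ring.
Qed.

Lemma conn_vv : conn x y = 2^-1 *: br x y.
Proof. by rewrite /conn !adj_compl0// !subr0. Qed.

End Values.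

Section CurvValues.
Variables (z z' x y : 'rV[R]_n).
Hypotheses (zc : lie_center br z) (z'c : lie_center br z').
Hypotheses (xv : center_compl br ip x) (yv : center_compl br ip y).

Let adj_v := adj_compl.

Lemma curv_zzz z2 : lie_center br z2 -> curv z z' z2 = 0.
Proof.
move=> z2c; rewrite /curv zc (conn_zz z'c z2c) (conn_zz zc z2c).
by rewrite !(bilin0r conn_bilin) (bilin0l conn_bilin) !subr0.
Qed.

Lemma curv_zvz : curv z x z' = 4^-1 *: adj z (adj z' x).
Proof.
rewrite /curv zc (conn_zz zc z'c) (conn_vz z'c xv) (bilinZr conn_bilin).
rewrite (conn_zv zc (adj_v _ _)) (bilin0r conn_bilin) (bilin0l conn_bilin).
by apply/rowP => i; rewrite !mxE; field.
Qed.

Lemma curv_zvv : curv z x y = 4^-1 *: br x (adj z y).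
Proof.
rewrite /curv zc (conn_vv xv yv) (conn_zv zc yv) !(bilinZr conn_bilin).
rewrite (conn_zz zc (br_center _ _)) (conn_vv xv (adj_v _ _)) (bilin0l conn_bilin).
by apply/rowP => i; rewrite !mxE; field.
Qed.

Lemma curv_vvv : curv y x x = (3 / 4) *: adj (br y x) x.
Proof.
rewrite /curv (conn_vv xv xv) (conn_vv yv xv) brxx scaler0 (bilin0r conn_bilin).
rewrite (bilinZr conn_bilin) (conn_vz (br_center _ _) xv).
rewrite (conn_zv (br_center _ _) xv).
by apply/rowP => i; rewrite !mxE; field.
Qed.

End CurvValues.

(** Since [conn x x] is 0, two terms survive. With w = [x, J_z x] they are - J_w x / 8 and - 3 J_w x
    / 8. Once w is a multiple of z, this yields J_z x itself, an odd power of J_z. *)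
Lemma nabla_curv_vzvv z x : lie_center br z -> center_compl br ip x ->
  nabla_curv x z x x = - 2^-1 *: adj (br x (adj z x)) x.
Proof.
move=> zc xv; rewrite /nabla_curv (conn_vv xv xv) brxx scaler0.
have jv := adj_compl z x.
have c0 : curv z x 0 = 0.
  rewrite /curv !(bilin0r conn_bilin).
  by rewrite !subr0.
have c0' : curv z 0 x = 0.
  rewrite /curv (bilin0r br_bilin) !(bilin0l conn_bilin) (bilin0r conn_bilin).
  by rewrite !subr0.
have cl a u : curv (a *: u) x x = a *: curv u x x.
  rewrite /curv !(bilinZl conn_bilin) !(bilinZl br_bilin) (bilinZl conn_bilin).
  by rewrite (bilinZr conn_bilin) -!scalerBr.
rewrite c0 c0' (conn_vz zc xv) cl (curv_zvv zc xv xv) (curv_vvv xv jv).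
rewrite (bilinZr conn_bilin) (conn_vz (br_center _ _) xv) [br (adj z x) x]brC.
rewrite (bilinNl adj_bilin).
by apply/rowP => i; rewrite !mxE; field.
Qed.

End TwoStep.
Arguments adj {R n} br ip t x.
Arguments conn {R n} br ip a b.
Arguments curv {R n} br ip a b c.
Arguments nabla_curv {R n} br ip d a b c.

(** * Orthogonal splitting into the center and its complement *)

Section CenterSplitting.
Context {R : realType} {n : nat}.
Context {br : 'rV[R]_n -> 'rV[R]_n -> 'rV[R]_n} {ip : 'rV[R]_n -> 'rV[R]_n -> R}.
Hypothesis br_lie : is_lie_bracket br.
Hypothesis br_two_step : two_step_nilpotent br.
Hypothesis ip_inner : is_inner_product ip.
Hypothesis center_nondeg : nondegenerate_on ip (lie_center br).
Let brb := br_bilin br_lie.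
Let adjb := adj_bilin br_lie ip_inner.
Let ipadj := ip_adj br_lie ip_inner.

(** The map t |-> ad_t with its matrix values flattened to rows. Its kernel presents the center as a
    row space, to which matrix algebra applies. *)
Definition bracket_mx : 'M[R]_(n, n * n) :=
  \matrix_(i < n) mxvec (\matrix_(j < n) br (basis_vec i) (basis_vec j)).

Lemma mul_bracket_mx t :
  t *m bracket_mx = mxvec (\matrix_(j < n) br t (basis_vec j)).
Proof.
rewrite mulmx_sum_row; under eq_bigr do rewrite rowK -linearZ.
rewrite -linear_sum; congr mxvec; apply/row_matrixP => j.
rewrite rowK linear_sum {2}[t]row_sum_basis bilin_suml//.
by apply: eq_bigr => i _; rewrite linearZ/= rowK bilinZl.
Qed.

Definition center_mx := row_base (kermx bracket_mx).

Lemma center_mxP t : (t <= center_mx)%MS <-> lie_center br t.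
Proof.
rewrite eq_row_base; split=> [/sub_kermxP|tc].
  rewrite mul_bracket_mx => /(congr1 vec_mx); rewrite mxvecK linear0 => t0 y.
  rewrite [y]row_sum_basis bilin_sumr// big1// => j _.
  have := congr1 (row j) t0; rewrite rowK linear0 bilinZr// => ->.
  by rewrite scaler0.
apply/sub_kermxP; rewrite mul_bracket_mx; apply/eqP; rewrite mxvec_eq0.
by apply/eqP/row_matrixP => j; rewrite rowK linear0 tc.
Qed.

Definition center_gram := center_mx *m ip_mx ip *m center_mx^T.

Lemma center_gram_unit : center_gram \in unitmx.
Proof.
rewrite -row_free_unit; apply: inj_row_free => v v0.
have C0 : v *m center_mx = 0.
  apply: center_nondeg; first by apply/center_mxP; exact: submxMl.
  move=> t' /center_mxP/submxP[w ->]; rewrite -ip_mxE// trmx_mul.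
  have -> : v *m center_mx *m ip_mx ip *m (center_mx^T *m w^T) =
            v *m center_gram *m w^T by rewrite /center_gram !mulmxA.
  by rewrite v0 mul0mx mxE.
by apply: (row_free_inj (row_base_free _)); rewrite C0 mul0mx.
Qed.

(** Orthogonal projection for row vectors: pairing with a basis of the center, corrected by the
    inverse of its Gram matrix, which exists because the center is nondegenerate. *)
Definition center_proj : 'M[R]_n :=
  ip_mx ip *m center_mx^T *m invmx center_gram *m center_mx.

Lemma center_projP u : lie_center br (u *m center_proj).
Proof. by apply/center_mxP; rewrite mulmxA submxMl. Qed.

Definition compl_proj : 'M[R]_n := 1%:M - center_proj.

Lemma compl_projP u : center_compl br ip (u *m compl_proj).
Proof.
have K : u *m compl_proj *m ip_mx ip *m center_mx^T = 0.
  rewrite mulmxBr mulmx1 !mulmxBl /center_proj.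
  have -> : u *m (ip_mx ip *m center_mx^T *m invmx center_gram *m center_mx)
     *m ip_mx ip *m center_mx^T =
     u *m ip_mx ip *m center_mx^T *m invmx center_gram *m center_gram.
    by rewrite /center_gram !mulmxA.
  by rewrite mulmxKV ?center_gram_unit// subrr.
move=> t /center_mxP/submxP[w ->]; rewrite -ip_mxE// trmx_mul.
by rewrite mulmxA K mul0mx mxE.
Qed.

Lemma center_split (u : 'rV[R]_n) : u = u *m center_proj + u *m compl_proj.
Proof. by rewrite mulmxBr mulmx1 addrC subrK. Qed.

Lemma center_compl_disj t : lie_center br t -> center_compl br ip t -> t = 0.
Proof. by move=> tc tv; apply: center_nondeg => // t' /tv. Qed.

Lemma compl_proj_id x : center_compl br ip x -> x *m compl_proj = x.
Proof.
move=> xv; apply/eqP; rewrite -subr_eq0; apply/eqP.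
have E : x *m compl_proj - x = - (x *m center_proj).
  by rewrite {2}(center_split x) opprD addrC addrNK.
apply: center_compl_disj.
  by rewrite E -scaleN1r; apply: lie_centerZ => //; exact: center_projP.
by rewrite addrC -scaleN1r; apply: center_complP => //; exact: compl_projP.
Qed.

Lemma center_proj_id t : lie_center br t -> t *m center_proj = t.
Proof.
move=> tc; apply/eqP; rewrite -subr_eq0; apply/eqP.
have E : t *m center_proj - t = - (t *m compl_proj).
  by rewrite {2}(center_split t) opprD addrA subrr add0r.
apply: center_compl_disj.
  by rewrite addrC -scaleN1r; apply: lie_centerP => //; exact: center_projP.
by rewrite E -scaleN1r; apply: center_complZ => //; exact: compl_projP.
Qed.

Lemma ip_inj_compl x x' : center_compl br ip x -> center_compl br ip x' ->
  (forall y, center_compl br ip y -> ip x y = ip x' y) -> x = x'.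
Proof.
move=> xv x'v xx'; apply: (ip_inj ip_inner) => y.
rewrite (center_split y) !(ipDr ip_inner) (xv _ (center_projP _)).
by rewrite (x'v _ (center_projP _)) (xx' _ (compl_projP _)).
Qed.

Lemma ip_inj_center t t' : lie_center br t -> lie_center br t' ->
  (forall s, lie_center br s -> ip t s = ip t' s) -> t = t'.
Proof.
move=> tc t'c tt'; apply/eqP; rewrite -subr_eq0; apply/eqP.
apply: center_nondeg.
  by rewrite addrC -scaleN1r; apply: lie_centerP.
by move=> s sc; rewrite !ipE// tt'// subrr.
Qed.

(** Two candidates for [xget] lie in v and have the same products with v, hence coincide; [adj] is a
    candidate, so the default 0 of [xget] is not reached. *)
Lemma Jop_adj t x : center_compl br ip x -> Jop br ip t x = adj br ip t x.
Proof.
move=> xv; rewrite /Jop; case: xgetP => [w -> [wv wE]|].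
  apply: ip_inj_compl => //; first exact: adj_compl.
  by move=> y yv; rewrite wE// ipadj.
move=> /(_ (adj br ip t x))[]; split; first exact: adj_compl.
by move=> y _; rewrite ipadj.
Qed.

(** Polarization: if every vector of A were null, all products in A would vanish and u would lie in
    the radical. *)
Lemma exists_nonnull (A : set 'rV[R]_n) u :
  (forall a x y, A x -> A y -> A (a *: x + y)) -> A u -> u != 0 ->
  (forall x, A x -> (forall y, A y -> ip x y = 0) -> x = 0) ->
  exists2 x, A x & nonnull ip x.
Proof.
move=> AP Au u0 An; apply/not_exists2P => null.
have nul x : A x -> ip x x = 0.
  by move=> Ax; have [//|/negP] := null x; rewrite /nonnull negbK => /eqP.
move/eqP : u0; apply; apply: An => // y Ay.
have := nul _ (AP 1 _ _ Au Ay); rewrite scale1r !ipE// (nul _ Au) (nul _ Ay).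
rewrite [ip y u]ipC//; lra.
Qed.

Lemma ex_nonnull_center : exists2 z, lie_center br z & nonnull ip z.
Proof.
have [x [y xy]] := br_two_step.1.
apply: (exists_nonnull _ (br_center br_lie br_two_step x y) xy) => [a s t|t].
  exact: lie_centerP.
exact: center_nondeg.
Qed.

Lemma compl_nondeg x : center_compl br ip x ->
  (forall y, center_compl br ip y -> ip x y = 0) -> x = 0.
Proof.
move=> xv x0; apply: ip_inj_compl => //; first exact: center_compl0.
by move=> y yv; rewrite x0// ip0l.
Qed.

Lemma ex_nonnull_compl : exists2 x, center_compl br ip x & nonnull ip x.
Proof.
have [x [y xy]] := br_two_step.1.
apply: (exists_nonnull _ (compl_projP x)) => [a s t||t].
- exact: center_complP.
- apply: contra_neq xy => x0; rewrite (center_split x) x0 addr0.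
  exact: center_projP.
- exact: compl_nondeg.
Qed.

Hypothesis N_pseudoregular : pseudoregular br ip.

Lemma adj_inj0 z x : lie_center br z -> nonnull ip z -> center_compl br ip x ->
  adj br ip z x = 0 -> x = 0.
Proof.
move=> zc zn xv zx; have [_ /(_ z zc zn)[_ inj _]] := N_pseudoregular.
have v0 : center_compl br ip 0 by exact: center_compl0.
apply: inj; rewrite ?inE// !Jop_adj// zx.
by rewrite (bilin0r adjb).
Qed.

(** Surjectivity of ad_x is dual to injectivity of z |-> J_z x: every central t is a bracket [x, y],
    and <z, [x, y]> = <J_z x, y>. *)
Lemma adj_injl0 z x : lie_center br z -> center_compl br ip x -> nonnull ip x ->
  adj br ip z x = 0 -> z = 0.
Proof.
move=> zc xv xn zx; apply: center_nondeg => // t tc.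
have [/(_ x xv xn) sj _] := N_pseudoregular.
have [y _ <-] := sj t tc.
by rewrite -ipadj zx ip0l.
Qed.

Lemma adj_surj z y : lie_center br z -> nonnull ip z -> center_compl br ip y ->
  exists2 x, center_compl br ip x & adj br ip z x = y.
Proof.
move=> zc zn yv; have [_ /(_ z zc zn)[_ _ sj]] := N_pseudoregular.
by have [x xv <-] := sj y yv; exists x => //; rewrite Jop_adj.
Qed.

End CenterSplitting.
Arguments center_proj {R n} br ip.
Arguments compl_proj {R n} br ip.

(** * From invariant 3-planes to a homothety *)

Section LinePolynomials.
Context {R : realType} {V : lmodType R}.
Implicit Types f g : V -> R.

(** Polynomial functions, tested on affine lines only. Any two points share a line, which suffices
    for the density arguments below and keeps them in one variable. *)
Definition line_poly f :=
  forall x u, exists p : {poly R}, forall t, f (x + t *: u) = p.[t].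

Lemma horner0_eq0 (p : {poly R}) : (forall t, p.[t] = 0) -> p = 0.
Proof.
move=> p0; apply/eqP/negPn/negP => pn.
have := max_poly_roots (rs := [seq i%:R | i <- iota 0 (size p)]) pn.
rewrite size_map size_iota ltnn => H; suff : false by [].
apply: H; first by apply/allP => t _; apply/eqP/p0.
by rewrite map_inj_in_uniq ?iota_uniq// => i j _ _ /eqP; rewrite eqr_nat => /eqP.
Qed.

Lemma line_poly_mul f g : line_poly f -> line_poly g -> line_poly (fun x => f x * g x).
Proof.
move=> fp gp x u; have [p pE] := fp x u; have [q qE] := gp x u.
by exists (p * q) => t; rewrite hornerM pE qE.
Qed.

Lemma line_poly_add f g : line_poly f -> line_poly g -> line_poly (fun x => f x + g x).
Proof.
move=> fp gp x u; have [p pE] := fp x u; have [q qE] := gp x u.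
by exists (p + q) => t; rewrite hornerD pE qE.
Qed.

Lemma line_poly_lin f : (forall a x y, f (a *: x + y) = a * f x + f y) -> line_poly f.
Proof.
move=> fl x u; exists ((f u)%:P * 'X + (f x)%:P) => t.
by rewrite addrC fl !hornerE mulrC.
Qed.

Lemma line_poly_bilin (b : V -> V -> R) :
  (forall a x x' y, b (a *: x + x') y = a * b x y + b x' y) ->
  (forall a x y y', b x (a *: y + y') = a * b x y + b x y') ->
  line_poly (fun x => b x x).
Proof.
move=> bl br x u; exists ((b u u)%:P * ('X * 'X) + (b u x + b x u)%:P * 'X + (b x x)%:P) => t.
rewrite addrC bl !br !hornerE /=; ring.
Qed.

(** On the line through a and b both functions are nonzero polynomials, and polynomials form an
    integral domain. *)
Lemma line_poly_mul_neq0 f g a b : line_poly f -> line_poly g ->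
  f a != 0 -> g b != 0 -> exists c, f c * g c != 0.
Proof.
move=> fp gp fa gb; have [p pE] := fp a (b - a); have [q qE] := gp a (b - a).
apply: contrapT => H; have /eqP : p * q = 0.
  apply: horner0_eq0 => t; apply/eqP/negPn/negP => pq; apply: H.
  by exists (a + t *: (b - a)); rewrite pE qE -hornerM.
rewrite mulf_eq0 => /orP[/eqP p0|/eqP q0].
  by move: fa; rewrite -[a]addr0 -(scale0r (b - a)) pE p0 horner0 eqxx.
move: gb; have -> : b = a + 1 *: (b - a) by rewrite scale1r addrC subrK.
by rewrite qE q0 horner0 eqxx.
Qed.

(** Algebraic form of the density of the points where g does not vanish. *)
Lemma line_poly_generic f g a : line_poly f -> line_poly g -> g a != 0 ->
  (forall x, g x != 0 -> f x = 0) -> forall x, f x = 0.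
Proof.
move=> fp gp ga gf x; apply/eqP/negPn/negP => fx.
have [c] := line_poly_mul_neq0 gp fp ga fx.
by rewrite mulf_eq0 negb_or => /andP[/gf ->]; rewrite eqxx.
Qed.

End LinePolynomials.

Section Homothety.
Context {R : realType} {n : nat}.
Context {br : 'rV[R]_n -> 'rV[R]_n -> 'rV[R]_n} {ip : 'rV[R]_n -> 'rV[R]_n -> R}.
Hypothesis br_lie : is_lie_bracket br.
Hypothesis br_two_step : two_step_nilpotent br.
Hypothesis ip_inner : is_inner_product ip.
Hypothesis center_nondeg : nondegenerate_on ip (lie_center br).
Hypothesis N_pseudoregular : pseudoregular br ip.
Local Notation J := (adj br ip).
Local Notation Z := (lie_center br).
Local Notation X := (center_compl br ip).
Let brb := br_bilin br_lie.
Let Jb := adj_bilin br_lie ip_inner.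
Let cb := conn_bilin br_lie ip_inner.
Let ipJ := ip_adj br_lie ip_inner.
Let Jv := adj_compl br_lie ip_inner.
Let Jskew := adj_skew br_lie ip_inner.
Let XP := @center_complP _ _ br _ ip_inner.
Let XZ := @center_complZ _ _ br _ ip_inner.
Let ZP := lie_centerP br_lie.
Let ZZ := lie_centerZ br_lie.
Let brc := br_center br_lie br_two_step.

(** Dimension at most 3, phrased without a basis because the tangent space is given only as a
    set. *)
Definition dependent4 (h : set 'rV[R]_n) : Prop :=
  forall u1 u2 u3 u4, h u1 -> h u2 -> h u3 -> h u4 ->
  exists a b c d : R, [|| a != 0, b != 0, c != 0 | d != 0] /\
    a *: u1 + b *: u2 + c *: u3 + d *: u4 = 0.

(** All that is retained of a totally geodesic H is that its tangent space at the identity has these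
    properties; what follows is linear algebra. *)
Record curvature_invariant (h : set 'rV[R]_n) : Prop := CurvatureInvariant {
  invP : forall a u w, h u -> h w -> h (a *: u + w);
  inv_curv : forall a b c, h a -> h b -> h c -> h (curv br ip a b c);
  inv_nabla : forall d a b c, h d -> h a -> h b -> h c ->
    h (nabla_curv br ip d a b c);
  inv_dep : dependent4 h }.

Lemma split0 z x : Z z -> X x -> z + x = 0 -> z = 0 /\ x = 0.
Proof.
move=> zc xv /eqP; rewrite addr_eq0 => /eqP E.
have z0 : z = 0.
  apply: (center_compl_disj center_nondeg) => //.
  by rewrite E -scaleN1r; exact: XZ.
by split=> //; apply/eqP; rewrite -oppr_eq0 -E z0.
Qed.

Lemma split40 a b c d z1 z2 x1 x2 : Z z1 -> Z z2 -> X x1 -> X x2 ->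
  a *: z1 + b *: z2 + c *: x1 + d *: x2 = 0 ->
  a *: z1 + b *: z2 = 0 /\ c *: x1 + d *: x2 = 0.
Proof.
move=> z1c z2c x1v x2v; rewrite -addrA; apply: split0.
  by apply: ZP => //; exact: ZZ.
by apply: XP => //; exact: XZ.
Qed.

Lemma lin_dep2 (V : lmodType R) (a b : R) (u w : V) :
  b != 0 -> a *: u + b *: w = 0 -> w = (- (a / b)) *: u.
Proof.
move=> b0 /eqP; rewrite addrC addr_eq0 => /eqP E.
by rewrite -[w]scale1r -(mulVf b0) -scalerA E scalerN scalerA mulrC scaleNr.
Qed.

Section Slice.
Variables (h : set 'rV[R]_n) (z x : 'rV[R]_n).
Hypothesis hinv : curvature_invariant h.
Hypotheses (zc : Z z) (zn : nonnull ip z) (xv : X x).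

Let hZ a u : h u -> h (a *: u).
Proof.
by move=> hu; have := invP hinv (a - 1) hu hu; rewrite scalerBl scale1r subrK.
Qed.

Let hK a u : a != 0 -> h (a *: u) -> h u.
Proof. by move=> a0 /(hZ a^-1); rewrite scalerA mulVf// scale1r. Qed.

Let nz4 : (4^-1 : R) != 0. Proof. by rewrite invr_eq0 pnatr_eq0. Qed.

Lemma h_J2 z' z'' y : Z z' -> Z z'' -> X y -> h z' -> h z'' -> h y -> h (J z' (J z'' y)).
Proof.
move=> z'c z''c yv hz' hz'' hy; apply: (hK nz4).
have := inv_curv hinv hz' hy hz''.
by rewrite (curv_zvz br_lie br_two_step ip_inner z'c z''c yv).
Qed.

(** Write J for J_z'. As R(z', z + x)z' = J^2 x / 4, h contains z', z + x, J^2 x and J^4 x. A linear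
    relation between these four splits into a central part and a part in v. *)
Lemma invariant_components z' : x != 0 -> h (z + x) -> Z z' -> h z' ->
  nonnull ip z' -> h z /\ h x.
Proof.
move=> x0 hzx z'c hz' z'n.
have T2 y : X y -> h (z + y) -> h (J z' (J z' y)).
  move=> yv hzy; apply: (hK nz4).
  have := inv_curv hinv hz' hzy hz'.
  have -> : curv br ip z' (z + y) z' = curv br ip z' z z' + curv br ip z' y z'.
    rewrite /curv (bilinDl cb z y z') (bilinDr cb z') (bilinDl cb z y) (bilinDr brb z').
    rewrite (bilinDl cb (br z' z)) 2!opprD.
    by rewrite [X in X + _ = _]addrACA [LHS]addrACA.
  rewrite (curv_zzz br_lie ip_inner z'c zc z'c) add0r.
  by rewrite (curv_zvz br_lie br_two_step ip_inner z'c z'c yv).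
have hx2 := T2 x xv hzx.
have inj2 y : X y -> J z' (J z' y) = 0 -> y = 0.
  move=> yv /(adj_inj0 br_lie ip_inner center_nondeg N_pseudoregular z'c z'n (Jv _ _)).
  exact: (adj_inj0 br_lie ip_inner center_nondeg N_pseudoregular z'c z'n).
have hx4 : h (J z' (J z' (J z' (J z' x)))) by apply: h_J2.
have zx : h x -> h z.
  by move=> hx; have := invP hinv (-1) hx hzx; rewrite scaleN1r addrC addrK.
have [a [b [c [d [nz E]]]]] := inv_dep hinv hz' hzx hx2 hx4.
have [] := @split0 (a *: z' + b *: z) (b *: x + c *: J z' (J z' x)
   + d *: J z' (J z' (J z' (J z' x)))).
- by apply: ZP => //; exact: ZZ.
- rewrite -addrA; apply: XP => //.
  by apply: XP; [exact: Jv|apply: XZ => //; exact: Jv].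
- by rewrite -[RHS]E scalerDr !addrA.
(* If b is nonzero, z is a multiple of z'. Otherwise a = 0 as well and c J^2 x + d J^4 x = 0;
   cancelling J^2 makes J^2 x, which is in h, a nonzero multiple of x. *)
have [b0|b0] := eqVneq b 0.
  rewrite b0 !scale0r addr0 add0r => /eqP.
  rewrite scaler_eq0 (negbTE (nonnull_neq0 ip_inner z'n)) orbF => /eqP a0.
  rewrite a0 b0 eqxx /= in nz => E2.
  have E3 : c *: x + d *: J z' (J z' x) = 0.
    apply: inj2; first by apply: XP => //; apply: XZ => //; exact: Jv.
    by rewrite !(bilinDr Jb) !(bilinZr Jb).
  have d0 : d != 0.
    apply: contraTneq nz => d0; move: E3 => /eqP.
    by rewrite d0 scale0r addr0 scaler_eq0 (negbTE x0) orbF eqxx orbF => ->.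
  have kx := lin_dep2 d0 E3.
  have k0 : - (c / d) != 0.
    by apply: contra_neq x0 => k0; apply: inj2; rewrite // kx k0 scale0r.
  have hx : h x by apply: (hK k0); rewrite -kx.
  by split=> //; exact: zx.
move=> /(lin_dep2 b0) zE _.
have hz : h z by rewrite zE; exact: hZ.
by split=> //; have := invP hinv (-1) hz hzx; rewrite scaleN1r addKr.
Qed.

Hypotheses (hz : h z) (hx : h x) (xn : nonnull ip x).

Lemma h_bracket : h (br x (J z x)).
Proof.
apply: (hK nz4); have := inv_curv hinv hz hx hx.
by rewrite (curv_zvv br_lie br_two_step ip_inner zc xv xv).
Qed.

(* [x, J_z x] lies on the line of z: otherwise z, x and [x, J_z x] would span h,
   and some J_w with w nonzero would kill x. *)
Lemma invariant_bracket : exists l, br x (J z x) = l *: z.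
Proof.
have hw := h_bracket; set w := br x (J z x) in hw *.
have wc : Z w by exact: brc.
have z0 := nonnull_neq0 ip_inner zn; have x0 := nonnull_neq0 ip_inner xn.
have dep y : X y -> h y -> (exists l, w = l *: z) \/ (exists k, y = k *: x).
  move=> yv hy; have [a [b [c [d [nz]]]]] := inv_dep hinv hz hw hx hy.
  move=> /(split40 zc wc xv yv)[E1 E2].
  have [b0|b0] := eqVneq b 0; last by left; exists (- (a / b)); exact: lin_dep2.
  right; have [d0|d0] := eqVneq d 0; last by exists (- (c / d)); exact: lin_dep2.
  move: nz E1 E2; rewrite b0 d0 !scale0r !addr0 eqxx !orbF.
  move=> /orP[a0|c0] /eqP E1 /eqP E2.
    by move: E1; rewrite scaler_eq0 (negbTE a0) (negbTE z0).
  by move: E2; rewrite scaler_eq0 (negbTE c0) (negbTE x0).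
have [//|[k1 E1]] := dep _ (Jv z (J w x)) (h_J2 zc wc xv hz hw hx).
have [//|[k2 E2]] := dep _ (Jv z (J z x)) (h_J2 zc zc xv hz hz hx).
have k20 : k2 != 0.
  apply: contra_neq x0 => k20; move: E2; rewrite k20 scale0r.
  move/(adj_inj0 br_lie ip_inner center_nondeg N_pseudoregular zc zn (Jv _ _)).
  exact: (adj_inj0 br_lie ip_inner center_nondeg N_pseudoregular zc zn xv).
(* From J_z J_w x = k1 x and J_z^2 x = k2 x, the central vector w - (k1 / k2) z is sent to 0 by t
   |-> J_z J_t x, which is injective. *)
exists (k1 / k2); apply/eqP; rewrite -subr_eq0 -scaleNr addrC; apply/eqP.
apply: (adj_injl0 br_lie ip_inner center_nondeg N_pseudoregular (ZP _ zc wc) xv xn).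
apply: (adj_inj0 br_lie ip_inner center_nondeg N_pseudoregular zc zn (Jv _ _)).
rewrite Jb.1 Jb.2 E1 E2 scalerA mulNr divfK// scaleNr addrC subrr.
by [].
Qed.

(** Because <z, [x, J_z x]> = <J_z x, J_z x> is nonzero, [x, J_z x] is a nonzero multiple of z, and
    nabla R puts J_z x in h. In a relation between z, x, J_z x and J_z^2 x the third coefficient is
    0, as J_z x is orthogonal to x and to J_z^2 x. *)
Lemma invariant_J2 : nonnull ip (J z x) -> exists l, J z (J z x) = l *: x.
Proof.
move=> jn; have [l lE] := invariant_bracket.
have l0 : l != 0.
  apply: contraNneq jn => l0; rewrite ipJ lE l0 scale0r ip0r//.
have hj : h (J z x).
  have m0 : - (2^-1 * l) != 0 by rewrite oppr_eq0 mulf_neq0// invr_eq0 pnatr_eq0.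
  apply: (hK m0); have := inv_nabla hinv hx hz hx hx.
  rewrite (nabla_curv_vzvv br_lie br_two_step ip_inner zc xv) lE (bilinZl Jb).
  by rewrite scalerA mulNr.
have hjj := h_J2 zc zc xv hz hz hx.
have [a [b [c [d [nz]]]]] := inv_dep hinv hz hx hj hjj.
rewrite -!addrA => /split0[].
- exact: ZZ.
- apply: XP => //; apply: XP; [exact: Jv|apply: XZ; exact: Jv].
have skew y : ip (J z y) y = 0 by rewrite ipJ brxx// ip0r.
move=> /eqP; rewrite scaler_eq0 (negbTE (nonnull_neq0 ip_inner zn)) orbF => /eqP a0 E.
have c0 : c = 0.
  have := congr1 (ip^~ (J z x)) E.
  rewrite !(ipDl ip_inner) !(ipZl ip_inner) [ip x _]ipC// skew skew ip0l//.
  rewrite !mulr0 addr0 add0r => /eqP.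
  by rewrite mulf_eq0 (negbTE jn) orbF => /eqP.
move: nz E; rewrite a0 c0 scale0r add0r eqxx /= => nz E.
have [d0|d0] := eqVneq d 0; last by exists (- (b / d)); exact: lin_dep2.
move: nz E; rewrite d0 eqxx !orbF scale0r addr0 => b0 /eqP.
by rewrite scaler_eq0 (negbTE b0) (negbTE (nonnull_neq0 ip_inner xn)).
Qed.

End Slice.

Hypothesis slices : forall z x, Z z -> nonnull ip z -> X x -> x != 0 ->
  exists h z', [/\ curvature_invariant h, h (z + x), h z', Z z' & nonnull ip z'].

Let slice z x : Z z -> nonnull ip z -> X x -> nonnull ip x ->
  exists2 h, curvature_invariant h & h z /\ h x.
Proof.
move=> zc zn xv xn; have x0 := nonnull_neq0 ip_inner xn.
have [h [z' [hinv hzx hz' z'c z'n]]] := slices zc zn xv x0.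
by exists h => //; exact: invariant_components hzx z'c hz' z'n.
Qed.

Let pi := compl_proj br ip.
Let piX u : X (u *m pi). Proof. exact: compl_projP. Qed.
Let pi_id x : X x -> x *m pi = x. Proof. exact: compl_proj_id. Qed.

Let J2_sym z x y : ip (J z (J z x)) y = ip x (J z (J z y)).
Proof. by rewrite Jskew [in LHS]Jskew opprK. Qed.

(* A self-adjoint operator with almost every vector an eigenvector is a scalar. *)
Lemma J2_scalar z : Z z -> nonnull ip z ->
  exists l, forall x, X x -> J z (J z x) = l *: x.
Proof.
move=> zc zn.
have [y0 y0v y0n] := ex_nonnull_compl br_lie br_two_step ip_inner center_nondeg.
(* A vector with J_z y1 = y0 nonnull, so that [q2] below is not identically zero. *)
have [y1 y1v y1E] := adj_surj br_lie ip_inner center_nondeg N_pseudoregular zc zn y0v.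
pose q1 u := ip (u *m pi) (u *m pi).
pose q2 u := ip (J z (u *m pi)) (J z (u *m pi)).
have q1p : line_poly q1.
  apply: (@line_poly_bilin _ _ (fun u w => ip (u *m pi) (w *m pi))) => *;
    by rewrite mulmxDl -scalemxAl !ipE.
have q2p : line_poly q2.
  apply: (@line_poly_bilin _ _ (fun u w => ip (J z (u *m pi)) (J z (w *m pi)))) => *;
    by rewrite mulmxDl -scalemxAl Jb.2 !ipE.
have q1n : q1 y0 != 0 by rewrite /q1 pi_id.
have q2n : q2 y1 != 0 by rewrite /q2 pi_id// y1E.
have qp := line_poly_mul q1p q2p.
have [a0 qn] := line_poly_mul_neq0 q1p q2p q1n q2n.
have eig u : q1 u * q2 u != 0 -> exists l, J z (J z (u *m pi)) = l *: (u *m pi).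
  rewrite mulf_eq0 negb_or => /andP[n1 n2].
  have [h hinv [hz hx]] := slice zc zn (piX u) n1.
  exact: invariant_J2 hinv zc zn (piX u) hz hx n1 n2.
have [l lE] := eig _ qn; exists l => x xv.
set a := a0 *m pi in lE; have an : ip a a != 0.
  by move: qn; rewrite mulf_eq0 negb_or => /andP[].
(* If u is an eigenvector not orthogonal to a, self-adjointness gives m <u, a> = <J_z^2 u, a> = <u,
   J_z^2 a> = l <u, a>, so its eigenvalue m is that of a. *)
pose q3 u := ip (u *m pi) a.
have q3p : line_poly q3.
  by apply: line_poly_lin => *; rewrite /q3 mulmxDl -scalemxAl !ipE.
have [b bn] := line_poly_mul_neq0 qp q3p qn (an : q3 a0 != 0).
apply: (ip_inj_compl br_lie ip_inner center_nondeg (Jv _ _) (XZ l xv)) => y yv.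
have fp : line_poly (fun u => ip (J z (J z (u *m pi)) - l *: (u *m pi)) y).
  apply: line_poly_lin => c u w.
  by rewrite mulmxDl -scalemxAl !Jb.2 !ipE//; ring.
have := line_poly_generic fp (line_poly_mul qp q3p) bn _ x.
rewrite pi_id// !ipE// => H; apply/eqP; rewrite -subr_eq0; apply/eqP; apply: H.
move=> u; rewrite mulf_eq0 negb_or => /andP[/eig[m mE] q3n].
rewrite mE -scalerBl ipZl//.
have /eqP : m * ip (u *m pi) a = l * ip (u *m pi) a.
  by rewrite -ipZl// -mE J2_sym lE ipZr.
by rewrite -subr_eq0 -mulrBl mulf_eq0 (negbTE q3n) orbF => /eqP ->; rewrite mul0r.
Qed.

(** For a fixed nonnull x1, the self-adjoint operator z |-> [x1, J_z x1] of the center is a scalar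
    l, by the same argument as for J_z^2. If J_z^2 is the scalar m, then l <z, z> = <J_z x1, J_z x1>
    = - m <x1, x1>, whence c = l / <x1, x1>. *)
Theorem J2_homothety : exists2 c, c != 0 &
  forall z x, Z z -> X x -> J z (J z x) = - (c * ip z z) *: x.
Proof.
have [x1 x1v x1n] := ex_nonnull_compl br_lie br_two_step ip_inner center_nondeg.
have [z1 z1c z1n] := ex_nonnull_center br_lie br_two_step ip_inner center_nondeg.
pose rho := center_proj br ip.
have rhoZ u : Z (u *m rho) by exact: center_projP.
have rho_id z : Z z -> z *m rho = z by exact: center_proj_id.
pose S u := br x1 (J (u *m rho) x1).
have Sip u w : ip (S u) (w *m rho) = ip (J (u *m rho) x1) (J (w *m rho) x1).
  by rewrite ipC// -ipJ ipC.
have Ssym u w : ip (S u) (w *m rho) = ip (S w) (u *m rho).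
  by rewrite !Sip ipC.
have SD a u w : S (a *: u + w) = a *: S u + S w.
  by rewrite /S mulmxDl -scalemxAl Jb.1 brb.2.
pose q u := ip (u *m rho) (u *m rho).
have qp : line_poly q.
  apply: (@line_poly_bilin _ _ (fun u w => ip (u *m rho) (w *m rho))) => *;
    by rewrite mulmxDl -scalemxAl !ipE.
have qn : q z1 != 0 by rewrite /q rho_id.
have eig u : q u != 0 -> exists l, S u = l *: (u *m rho).
  move=> un; have [h hinv [hz hx]] := slice (rhoZ u) un x1v x1n.
  exact: invariant_bracket hinv (rhoZ u) un x1v hz hx x1n.
have [l lE] := eig _ qn.
have Sl u s : ip (S u) s = l * ip (u *m rho) s.
  pose q3 u := ip (u *m rho) z1.
  have q3p : line_poly q3.
    by apply: line_poly_lin => *; rewrite /q3 mulmxDl -scalemxAl !ipE.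
  have q3n : q3 z1 != 0 by rewrite /q3 rho_id.
  have [b bn] := line_poly_mul_neq0 qp q3p qn q3n.
  have fp : line_poly (fun u => ip (S u) s - l * ip (u *m rho) s).
    by apply: line_poly_lin => c v w; rewrite SD mulmxDl -scalemxAl !ipE//; ring.
  apply/eqP; rewrite -subr_eq0; apply/eqP.
  apply: (line_poly_generic fp (line_poly_mul qp q3p) bn) => {}u.
  rewrite mulf_eq0 negb_or => /andP[/eig[m mE] u3].
  rewrite mE ipZl// -mulrBl.
  have /eqP : m * ip (u *m rho) z1 = l * ip (u *m rho) z1.
    by rewrite -ipZl// -mE -{1}(rho_id z1 z1c) Ssym lE rho_id// ipZl// [in RHS]ipC.
  by rewrite -subr_eq0 -mulrBl mulf_eq0 (negbTE u3) orbF => /eqP ->; rewrite mul0r.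
have J2n z : Z z -> nonnull ip z -> forall x, X x ->
    J z (J z x) = - (l / ip x1 x1 * ip z z) *: x.
  move=> zc zn x xv; have [m mE] := J2_scalar zc zn.
  rewrite mE//; congr (_ *: _); apply: (mulIf x1n).
  have := Sl z z; rewrite -[X in ip (S z) X]rho_id// Sip rho_id//.
  rewrite Jskew [ip x1 _]ipC// mE// ipZl// => /eqP; rewrite eqr_oppLR => /eqP ->.
  by rewrite mulNr mulrAC divfK.
(* If c were 0, then J_z1^2 x1 = 0, against the injectivity of J_z1. *)
exists (l / ip x1 x1).
  apply: contra_neq (nonnull_neq0 ip_inner x1n) => c0.
  have := J2n _ z1c z1n _ x1v; rewrite c0 mul0r oppr0 scale0r.
  move/(adj_inj0 br_lie ip_inner center_nondeg N_pseudoregular z1c z1n (Jv _ _)).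
  exact: (adj_inj0 br_lie ip_inner center_nondeg N_pseudoregular z1c z1n x1v).
(* Null z are reached by density: both sides are quadratic in z and agree wherever [q] is
   nonzero. *)
move=> z x zc xv; apply: (ip_inj ip_inner) => y.
set c := l / _ in J2n *.
have fp : line_poly (fun u => ip (J (u *m rho) (J (u *m rho) x)) y + c * q u * ip x y).
  apply: line_poly_add.
    apply: (@line_poly_bilin _ _ (fun u w => ip (J (u *m rho) (J (w *m rho) x)) y)) => *.
      by rewrite mulmxDl -scalemxAl Jb.1 !ipE.
    by rewrite mulmxDl -scalemxAl Jb.1 Jb.2 !ipE.
  have cp (k : R) : line_poly (fun _ : 'rV[R]_n => k).
    by move=> u w; exists k%:P => t; rewrite hornerC.
  by apply: line_poly_mul (cp _); apply: line_poly_mul qp; exact: cp.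
have := line_poly_generic fp qp qn _ z; rewrite /q rho_id// ipZl// => H.
apply/eqP; rewrite mulNr -subr_eq0 opprK; apply/eqP; apply: H => u un.
by rewrite J2n// ipZl// mulNr addNr.
Qed.

End Homothety.

(** * Covariant derivatives in the left trivialization *)

Section LeftTrivialization.
Context {R : realType} {n : nat}.
Context {br : 'rV[R]_n -> 'rV[R]_n -> 'rV[R]_n} {ip : 'rV[R]_n -> 'rV[R]_n -> R}.
Hypothesis br_lie : is_lie_bracket br.
Hypothesis br_two_step : two_step_nilpotent br.
Hypothesis ip_inner : is_inner_product ip.
Let brb := br_bilin br_lie.
Let brc := br_center br_lie br_two_step.
Local Notation g := (left_invariant_metric br ip).

(* The differential at p of left translation by p^-1, and its inverse. *)
Definition ltriv p u : 'rV[R]_n := u - 2^-1 *: br p u.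
Definition luntriv p u : 'rV[R]_n := u + 2^-1 *: br p u.

Lemma ltrivK p : cancel (ltriv p) (luntriv p).
Proof.
move=> u; rewrite /ltriv /luntriv (bilinBr brb) (bilinZr brb) br_two_step.2.
by rewrite scaler0 subr0 subrK.
Qed.

Lemma luntrivK p : cancel (luntriv p) (ltriv p).
Proof.
move=> u; rewrite /ltriv /luntriv (bilinDr brb) (bilinZr brb) br_two_step.2.
by rewrite scaler0 addr0 addrK.
Qed.

Lemma ltrivP p a u w : ltriv p (a *: u + w) = a *: ltriv p u + ltriv p w.
Proof.
by rewrite /ltriv brb.2; apply/rowP => i; rewrite !mxE; ring.
Qed.

Lemma luntrivP p a u w : luntriv p (a *: u + w) = a *: luntriv p u + luntriv p w.
Proof.
by rewrite /luntriv brb.2; apply/rowP => i; rewrite !mxE; ring.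
Qed.

Lemma br_ltriv p u w : br (ltriv p u) (ltriv p w) = br u w.
Proof.
rewrite /ltriv (bilinBl brb) !(bilinBr brb) !(bilinZl brb) !(bilinZr brb).
rewrite (brc p u w) (br_centerr br_lie _ (brc p w)) (brc p u).
by rewrite !scaler0 !subr0.
Qed.

Lemma is_derive_ltriv (V : normedModType R) (f w : V -> 'rV[R]_n) df dw x v :
  is_derive x v f df -> is_derive x v w dw ->
  is_derive x v (fun q => ltriv (f q) (w q))
    (dw - 2^-1 *: (br df (w x) + br (f x) dw)).
Proof.
move=> fd wd; apply: is_deriveB => //; apply: is_deriveZ.
exact: is_derive_bilin.
Qed.

Lemma is_derive_luntriv (V : normedModType R) (f w : V -> 'rV[R]_n) df dw x v :
  is_derive x v f df -> is_derive x v w dw ->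
  is_derive x v (fun q => luntriv (f q) (w q))
    (dw + 2^-1 *: (br df (w x) + br (f x) dw)).
Proof.
move=> fd wd; apply: is_deriveD => //; apply: is_deriveZ.
exact: is_derive_bilin.
Qed.

Lemma derive_grp_mul p u : 'D_u (grp_mul br (grp_inv p)) p = ltriv p u.
Proof.
have d1 : is_derive p u (fun q => - p + q) (0 + u).
  exact: is_deriveD (is_derive_cst _ _ _) (is_derive_id _ _).
have d2 : is_derive p u (fun q => 2^-1 *: br (- p) q)
    (2^-1 *: (br 0 p + br (- p) u)).
  apply: is_deriveZ; exact: is_derive_bilin (is_derive_cst _ _ _) (is_derive_id _ _).
have [_ E] := is_deriveD d1 d2.
apply: etrans E _.
by rewrite add0r (bilin0l brb) add0r (bilinNl brb) scalerN.
Qed.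

Lemma metricE p u w : g p u w = ip (ltriv p u) (ltriv p w).
Proof. by rewrite /left_invariant_metric !derive_grp_mul. Qed.

Lemma derive_metric p u w y : 'D_u (fun q => g q w y) p =
  ip (- (2^-1 *: br u w)) (ltriv p y) + ip (ltriv p w) (- (2^-1 *: br u y)).
Proof.
have -> : (fun q => g q w y) = (fun q => ip (ltriv q w) (ltriv q y)).
  by apply/funext => q; exact: metricE.
have d z : is_derive p u (fun q => ltriv q z) (- (2^-1 *: br u z)).
  apply: is_derive_eq (is_derive_ltriv (is_derive_id _ _) (is_derive_cst z _ _)) _.
  by rewrite (bilin0r brb) addr0 sub0r.
have [_ E] := is_derive_bilin (ip_bilin ip_inner) (d w) (d y).
exact: E.
Qed.

Lemma gram_mul p u : u *m gram g p = \row_l ip (ltriv p u) (ltriv p (basis_vec l)).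
Proof.
apply/rowP => l; rewrite !mxE.
have phiD x y : ip (ltriv p (x + y)) (ltriv p (basis_vec l)) =
    ip (ltriv p x) (ltriv p (basis_vec l)) + ip (ltriv p y) (ltriv p (basis_vec l)).
  by have := ltrivP p 1 x y; rewrite !scale1r => ->; rewrite ipDl.
have l0 : ltriv p 0 = 0 by rewrite /ltriv (bilin0r brb) scaler0 subr0.
have phi0 : ip (ltriv p 0) (ltriv p (basis_vec l)) = 0 by rewrite l0 ip0l.
rewrite {2}[u]row_sum_basis (big_morph (fun x => ip (ltriv p x) (ltriv p (basis_vec l))) phiD phi0).
apply: eq_bigr => i _; rewrite !mxE metricE.
by rewrite -[_ *: basis_vec i]addr0 ltrivP l0 addr0 ipZl.
Qed.

Lemma gram_unit p : gram g p \in unitmx.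
Proof.
rewrite -row_free_unit; apply: inj_row_free => u u0.
apply: (can_inj (ltrivK p)); rewrite {2}/ltriv (bilin0r brb) scaler0 subr0.
apply: (ip_nondeg ip_inner) => y; rewrite -(luntrivK p y).
set y' := luntriv p y; rewrite [y']row_sum_basis.
have phiD a b : ip (ltriv p u) (ltriv p (a + b)) =
    ip (ltriv p u) (ltriv p a) + ip (ltriv p u) (ltriv p b).
  by have := ltrivP p 1 a b; rewrite !scale1r => ->; rewrite ipDr.
have l0 : ltriv p 0 = 0 by rewrite /ltriv (bilin0r brb) scaler0 subr0.
have phi0 : ip (ltriv p u) (ltriv p 0) = 0 by rewrite l0 ip0r.
rewrite (big_morph (fun x => ip (ltriv p u) (ltriv p x)) phiD phi0).
apply: big1 => l _; rewrite -[_ *: basis_vec l]addr0 ltrivP l0 addr0 ipZr//.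
move: u0; rewrite gram_mul => /rowP/(_ l); rewrite !mxE => ->.
by rewrite mulr0.
Qed.

(** The Christoffel term becomes the symmetric part of [conn]. The Gram matrix need not be inverted
    explicitly: it is enough to multiply the claimed value by it. *)
Lemma christoffelE p u w : ltriv p (christoffel g p u w) =
  - (2^-1 *: (adj br ip (ltriv p u) (ltriv p w) + adj br ip (ltriv p w) (ltriv p u))).
Proof.
set rhs := - _; suff E : christoffel1 g p u w = luntriv p rhs *m gram g p.
  by rewrite /christoffel E mulmxK ?gram_unit// luntrivK.
rewrite gram_mul luntrivK; apply/rowP => l; rewrite [RHS]mxE.
set e := basis_vec l.
have -> : ip rhs (ltriv p e) =
    - (2^-1 * (ip (ltriv p u) (br w e) + ip (ltriv p w) (br u e))).
  by rewrite /rhs (ipNl ip_inner) (ipZl ip_inner) (ipDl ip_inner)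
    !(ip_adj br_lie ip_inner) !br_ltriv.
transitivity (2^-1 *
   (ip (- (2^-1 *: br u w)) (ltriv p e) + ip (ltriv p w) (- (2^-1 *: br u e))
  + (ip (- (2^-1 *: br w u)) (ltriv p e) + ip (ltriv p u) (- (2^-1 *: br w e)))
  - (ip (- (2^-1 *: br e u)) (ltriv p w) + ip (ltriv p u) (- (2^-1 *: br e w))))).
  by rewrite mxE; congr (_ * (_ + _ - _)); exact: derive_metric.
rewrite [br w u](brC br_lie) [br e u](brC br_lie) [br e w](brC br_lie).
move: (ltriv p u) (ltriv p w) (ltriv p e) => u' w' e'.
rewrite !ipE// [ip (br u e) _](ipC ip_inner).
move: (ip _ _) (ip _ _) (ip _ _) => a b c; by field.
Qed.

(** Differentiating the base point of [ltriv q (W q)] produces minus half a bracket, which cancels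
    the antisymmetric part of [conn]. *)
Lemma levi_civita_ltriv V W p : differentiable W p ->
  ltriv p (levi_civita g V W p) =
  'D_(V p) (fun q => ltriv q (W q)) p + conn br ip (ltriv p (V p)) (ltriv p (W p)).
Proof.
move=> Wd.
have [_ E] := is_derive_ltriv (is_derive_id p (V p))
  (derivableP (@diff_derivable _ _ _ _ _ (V p) Wd)).
rewrite [X in _ = X + _]E /levi_civita -[X in ltriv p (X + _)]scale1r ltrivP scale1r.
rewrite christoffelE /conn br_ltriv /ltriv /=.
by apply/rowP => i; rewrite !mxE; ring.
Qed.

End LeftTrivialization.
Arguments ltriv {R n} br p u.
Arguments luntriv {R n} br p u.

(** * Totally geodesic linear subspaces *)

Section LinearSubmanifolds.
Context {R : realType}.

Definition span {k n : nat} (M : 'M[R]_(k, n)) : set 'rV[R]_n := [set q | (q <= M)%MS].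

Lemma mul_copid_eq0 {n : nat} k (y : 'rV[R]_n) :
  y *m copid_mx k = 0 <-> forall j : 'I_n, (k <= j)%N -> y 0 j = 0.
Proof.
have E j : (y *m copid_mx k) 0 j = if (k <= j)%N then y 0 j else 0.
  rewrite mulmxBr mulmx1 !mxE (bigD1 j)//= big1 => [|i /negbTE ij]; last first.
    have ij' : (i == j :> nat) = false by exact: ij.
    by rewrite mxE ij' mulr0.
  rewrite mxE eqxx /= addr0.
  by case: (leqP k j) => _; rewrite ?mulr1 ?subrr ?mulr0 ?subr0.
split=> [/rowP y0 j kj|y0].
  by have := y0 j; rewrite E kj mxE.
by apply/rowP => j; rewrite E mxE; case: ifP => // /y0.
Qed.

Lemma smooth_on_lin {m n : nat} (U : set 'rV[R]_m) (A : 'M[R]_(m, n)) :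
  open U -> smooth_on U (fun q => q *m A).
Proof. by move=> oU; apply: (smooth_on_mulmx A oU) => k; exact: Ck_on_id. Qed.

(** A single linear chart: [row_ebase M] completes a basis of the row space, and in its coordinates
    those of index >= k vanish exactly on the row space. *)
Lemma span_submanifold {k n : nat} (M : 'M[R]_(k, n)) :
  row_free M -> is_submanifold k (span M).
Proof.
move=> /eqP rM; split; first by rewrite -{1}rM rank_leq_col.
move=> p pM; have Eu := row_ebase_unit M.
have im : (fun q : 'rV[R]_n => q *m invmx (row_ebase M)) @` setT = setT.
  rewrite eqEsubset; split=> // q _; exists (q *m row_ebase M) => //.
  by rewrite mulmxK.
exists setT, (fun q => q *m invmx (row_ebase M)), (fun q => q *m row_ebase M).
rewrite im; split.
- by split=> //; exact: openT.
- exact: openT.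
- by split; apply: smooth_on_lin; exact: openT.
- by move=> q _; rewrite mulmxKV.
- move=> q _; apply: iff_trans (mul_copid_eq0 _ _).
  rewrite /span /= submxE /cokermx rM mulmxA; split; first by move/eqP.
  by move=> ->.
Qed.

Lemma is_derive_span {k n : nat} (M : 'M[R]_(k, n)) (c : R -> 'rV[R]_n) v (t : R) :
  is_derive t (1 : R) c v -> (\forall s \near t, (c s <= M)%MS) -> (v <= M)%MS.
Proof.
move=> cd cM; rewrite submxE.
have [_ E] := is_derive_mulmx (cokermx M) cd.
apply/eqP; rewrite -E; transitivity ('D_1 (fun _ : R => (0 : 'rV[R]_n)) t).
  apply: near_eq_derive; apply: filterS cM => s.
  by rewrite submxE => /eqP.
exact: derive_cst.
Qed.

Lemma is_derive_segment {V : normedModType R} (p v : V) (t : R) :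
  is_derive t (1 : R) (fun s : R => p + s *: v) v.
Proof.
have l := is_derive_scalel v (is_derive_id t (1 : R)).
apply: is_derive_eq (is_deriveD (is_derive_cst p t 1) l) _.
by rewrite add0r scale1r.
Qed.

Lemma tangent_span {k n : nat} (M : 'M[R]_(k, n)) p v :
  (p <= M)%MS -> tangent (span M) p v <-> (v <= M)%MS.
Proof.
move=> pM; split=> [[c [_ cd cM]]|vM]; first exact: is_derive_span cd cM.
exists (fun s : R => p + s *: v); split.
- by rewrite scale0r addr0.
- exact: is_derive_segment.
- have cM (s : R) : ((p + s *: v)%R <= M)%MS by rewrite addmx_sub// scalemx_sub.
  exact: (@filterE _ (nbhs (0 : R)) _ _ cM).
Qed.

Lemma span_connected {k n : nat} (M : 'M[R]_(k, n)) : connected (span M).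
Proof.
rewrite (_ : span M = \bigcup_(q in span M) ((fun t : R => t *: q) @` setT)).
  apply: bigcup_connected.
    by exists 0 => q _; exists 0 => //; rewrite scale0r.
  move=> q _; apply: connected_continuous_connected.
    by apply/connected_intervalP => ? ? ? ? ? ?.
  by apply: continuous_subspaceT => t; exact: scalel_continuous.
apply/seteqP; split=> [q qM|_ [q qM [t _ <-]]] /=; last exact: scalemx_sub.
by exists q => //; exists 1 => //; rewrite scale1r.
Qed.

Lemma span_bilin {k n : nat} (M : 'M[R]_(k, n)) (b : 'rV[R]_n -> 'rV[R]_n -> 'rV[R]_n) :
  bilin b -> (forall i j, (b (row i M) (row j M) <= M)%MS) ->
  forall u w, (u <= M)%MS -> (w <= M)%MS -> (b u w <= M)%MS.
Proof.
move=> bb bM u w /submxP[a ->] /submxP[c ->].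
rewrite !mulmx_sum_row bilin_suml//; apply: summx_sub => i _.
rewrite bilinZl// scalemx_sub// bilin_sumr//; apply: summx_sub => j _.
by rewrite bilinZr// scalemx_sub.
Qed.

End LinearSubmanifolds.

Section TotallyGeodesicSpans.
Context {R : realType} {n : nat}.
Context {br : 'rV[R]_n -> 'rV[R]_n -> 'rV[R]_n} {ip : 'rV[R]_n -> 'rV[R]_n -> R}.
Hypothesis br_lie : is_lie_bracket br.
Hypothesis br_two_step : two_step_nilpotent br.
Hypothesis ip_inner : is_inner_product ip.
Local Notation g := (left_invariant_metric br ip).
Let brb := br_bilin br_lie.
Let Jb := adj_bilin br_lie ip_inner.

(** Closure under the bracket makes [ltriv q] and [luntriv q] preserve the span for q in it; closure
    under [adj] then keeps the Christoffel term inside. *)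
Lemma span_totally_geodesic {k : nat} (M : 'M[R]_(k, n)) :
  (forall i j, (br (row i M) (row j M) <= M)%MS) ->
  (forall i j, (adj br ip (row i M) (row j M) <= M)%MS) ->
  totally_geodesic g (span M).
Proof.
move=> brM JM U V W oU [Vs Vt] [Ws Wt] q Uq qM.
have brs := span_bilin brb brM; have Js := span_bilin Jb JM.
apply/tangent_span => //.
have VM : (V q <= M)%MS by apply/(tangent_span _ qM)/Vt.
have WM y : U y -> (y <= M)%MS -> (W y <= M)%MS.
  by move=> Uy yM; apply/(tangent_span _ yM)/Wt.
have Wd := smooth_on_differentiable Ws Uq.
have triv_in u : (u <= M)%MS -> (ltriv br q u <= M)%MS.
  move=> uM; apply: addmx_sub => //; rewrite eqmx_opp scalemx_sub//.
  exact: brs.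
have untriv_in u : (u <= M)%MS -> (luntriv br q u <= M)%MS.
  move=> uM; apply: addmx_sub => //; rewrite scalemx_sub//.
  exact: brs.
apply: addmx_sub.
  (* W is known to be tangent only at points of the span, so it is differentiated along the segment
     q + s V q, which stays there. *)
  have l := is_derive_segment q (V q) 0.
  have ld : differentiable (fun s : R => q + s *: V q) 0.
    by apply/derivable1_diffP; case: l.
  have q0 : q + (0 : R) *: V q = q by rewrite scale0r addr0.
  have Wd0 : differentiable W (q + (0 : R) *: V q) by rewrite q0.
  have := is_derive_chain ld l Wd0; rewrite q0 => /is_derive_span; apply.
  have : {for 0, continuous (fun s : R => q + s *: V q)}.
    exact: differentiable_continuous.
  move=> lc; have : \forall s \near (0 : R), U (q + s *: V q).
    by apply: lc; rewrite q0; exact: open_near.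
  by apply: filterS => s Us /=; apply: WM => //; rewrite addmx_sub// scalemx_sub.
rewrite -[christoffel _ _ _ _](ltrivK br_lie br_two_step q) christoffelE//.
apply: untriv_in; rewrite eqmx_opp scalemx_sub// addmx_sub//.
  by apply: Js; apply: triv_in => //; exact: WM.
by apply: Js; apply: triv_in => //; exact: WM.
Qed.

End TotallyGeodesicSpans.

(** * Invariant 3-planes for a metric homothetic to pseudoH-type *)

Section PseudoHType.
Context {R : realType} {n : nat}.
Context {br : 'rV[R]_n -> 'rV[R]_n -> 'rV[R]_n} {ip : 'rV[R]_n -> 'rV[R]_n -> R}.
Hypothesis br_lie : is_lie_bracket br.
Hypothesis br_two_step : two_step_nilpotent br.
Hypothesis ip_inner : is_inner_product ip.
Hypothesis center_nondeg : nondegenerate_on ip (lie_center br).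
Local Notation J := (adj br ip).
Local Notation Z := (lie_center br).
Local Notation X := (center_compl br ip).
Let brb := br_bilin br_lie.
Let Jb := adj_bilin br_lie ip_inner.
Let ipJ := ip_adj br_lie ip_inner.
Let Jv := adj_compl br_lie ip_inner.
Let Jskew := adj_skew br_lie ip_inner.
Let XP := @center_complP _ _ br _ ip_inner.
Let XZ := @center_complZ _ _ br _ ip_inner.

(** A factor c in the metric leaves v unchanged and cancels in the equation defining J; only <z, z>
    is multiplied. *)
Lemma homothetic_pseudoHP : homothetic_to_pseudoH_type br ip <->
  exists2 c, c != 0 & forall z x, Z z -> X x -> J z (J z x) = - (c * ip z z) *: x.
Proof.
have compl_scale c : c != 0 ->
    center_compl br (fun x y => c * ip x y) = center_compl br ip.
  move=> c0; apply/predeqP => x; split=> xv t tc; last by rewrite xv// mulr0.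
  by have /eqP := xv t tc; rewrite mulf_eq0 (negbTE c0) => /eqP.
have Jop_scale c : c != 0 -> Jop br (fun x y => c * ip x y) = Jop br ip.
  move=> c0; apply/funext => t; apply/funext => x.
  rewrite /Jop compl_scale//; congr (xget 0 _); apply/predeqP => w.
  split=> -[wv wE]; split=> // y yv; last by rewrite wE.
  exact: (mulfI c0 (wE y yv)).
split=> -[c c0 cH]; exists c => // z x zc.
  move=> xv; have := cH z x zc; rewrite compl_scale// Jop_scale// => /(_ xv).
  by rewrite !Jop_adj//; exact: Jv.
rewrite compl_scale// Jop_scale// => xv.
by rewrite !Jop_adj// cH.
Qed.

Variable c : R.
Hypothesis c0 : c != 0.
Hypothesis J2 : forall z x, Z z -> X x -> J z (J z x) = - (c * ip z z) *: x.

Lemma J_anticomm z z' x : Z z -> Z z' -> X x ->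
  J z (J z' x) + J z' (J z x) = - (2 * c * ip z z') *: x.
Proof.
move=> zc z'c xv.
have := J2 (lie_centerP br_lie 1 zc z'c) xv; rewrite !scale1r.
rewrite !(bilinDl Jb) !(bilinDr Jb) (J2 zc xv) (J2 z'c xv) !ipE// [ip z' z]ipC//.
move=> /rowP E; apply/rowP => i; have := E i; rewrite !mxE; lra.
Qed.

(** For central s, <s, [x, J_z x]> = <J_s x, J_z x>, and [J_anticomm] paired with x evaluates this
    as c <z, s> <x, x>. *)
Lemma bracket_J z x : Z z -> X x -> br x (J z x) = (c * ip x x) *: z.
Proof.
move=> zc xv; apply: (ip_inj_center br_lie ip_inner center_nondeg).
- exact: br_center.
- exact: lie_centerZ.
move=> s sc; rewrite [LHS]ipC// -ipJ ipZl//.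
have := congr1 (ip^~ x) (J_anticomm zc sc xv).
rewrite ipDl// !(Jskew _ (J _ _)) ipZl// [ip (J z x) _]ipC// => E.
lra.
Qed.

(** In general x0 and J_z x0 span the plane. If x0 = 0, a nonnull x replaces it: J_z x is nonzero
    and orthogonal to x, hence independent of it. *)
Lemma J_plane z x0 : Z z -> nonnull ip z -> X x0 ->
  exists x y, [/\ X x /\ X y,
    forall a b, a *: x + b *: y = 0 -> a = 0 /\ b = 0,
    exists l, br x y = l *: z,
    (exists a b, J z x = a *: x + b *: y) /\ (exists a b, J z y = a *: x + b *: y) &
    exists a b, x0 = a *: x + b *: y].
Proof.
move=> zc zn x0v; set mu := c * ip z z.
have mu0 : mu != 0 by rewrite mulf_neq0.
have J2z x : X x -> J z (J z x) = - mu *: x by exact: J2.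
have skew y : ip (J z y) y = 0 by rewrite ipJ brxx// ip0r.
have plane x : X x ->
    (forall a b, a *: x + b *: J z x = 0 -> a = 0 /\ b = 0) ->
    (exists a b, x0 = a *: x + b *: J z x) ->
  exists x y, [/\ X x /\ X y,
    forall a b, a *: x + b *: y = 0 -> a = 0 /\ b = 0,
    exists l, br x y = l *: z,
    (exists a b, J z x = a *: x + b *: y) /\ (exists a b, J z y = a *: x + b *: y) &
    exists a b, x0 = a *: x + b *: y].
  move=> xv ind ex; exists x, (J z x); split=> //.
  - by exists (c * ip x x); rewrite bracket_J.
  - split; first by exists 0, 1; rewrite scale0r add0r scale1r.
    by exists (- mu), 0; rewrite J2z// scale0r addr0.
have [x00|x00] := eqVneq x0 0.
  have [x xv xn] := ex_nonnull_compl br_lie br_two_step ip_inner center_nondeg.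
  apply: (plane x xv) => [a b E|]; last first.
    by exists 0, 0; rewrite !scale0r addr0.
  have a0 : a = 0.
    have := congr1 (ip^~ x) E; rewrite ipDl// !ipZl// skew mulr0 addr0 ip0l//.
    by move=> /eqP; rewrite mulf_eq0 (negbTE xn) orbF => /eqP.
  split=> //; move: E; rewrite a0 scale0r add0r => /eqP.
  rewrite scaler_eq0 => /orP[/eqP//|/eqP jx].
  have := J2z x xv; rewrite jx (bilin0r Jb) => /esym/eqP.
  by rewrite scaler_eq0 oppr_eq0 (negbTE mu0) (negbTE (nonnull_neq0 ip_inner xn)).
have [[l lE]|nl] := pselect (exists l, J z x0 = l *: x0); last first.
  apply: (plane x0 x0v) => [a b E|]; last by exists 1, 0; rewrite scale1r scale0r addr0.
  have [b0|b0] := eqVneq b 0; last by case: nl; exists (- (a / b)); exact: lin_dep2.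
  move: E; rewrite b0 scale0r addr0 => /eqP.
  by rewrite scaler_eq0 (negbTE x00) orbF => /eqP.
(* x0 is a null eigenvector of J_z; pair it with one for the opposite eigenvalue. *)
have l2 : l * l = - mu.
  have := J2z x0 x0v; rewrite lE (bilinZr Jb) lE scalerA => /eqP.
  by rewrite -subr_eq0 -scalerBl scaler_eq0 (negbTE x00) orbF subr_eq0 => /eqP.
have l0 : l != 0 by apply: contra_neq mu0 => l0; rewrite -[mu]opprK -l2 l0 mul0r oppr0.
have [u uv un] : exists2 u, X u & ip x0 u != 0.
  apply: contrapT => H; move/eqP : x00; apply.
  apply: (compl_nondeg br_lie ip_inner center_nondeg x0v) => y yv.
  by apply/eqP/negPn/negP => yn; apply: H; exists y.
(* As (J_z + l)(J_z - l) = 0, y belongs to the eigenvalue - l. It is nonzero: by skewness the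
   eigenspace of l is totally null, whereas u is not orthogonal to x0. *)
pose y := J z u - l *: u.
have yv : X y by rewrite /y addrC -scaleNr; apply: XP => //; exact: Jv.
have Jy : J z y = - l *: y.
  rewrite /y (bilinBr Jb) (bilinZr Jb) J2z// -l2.
  by apply/rowP => i; rewrite !mxE; ring.
have y0 : y != 0.
  apply: contra_neq un => y0.
  have Ju : J z u = l *: u by apply/eqP; rewrite -subr_eq0; apply/eqP.
  have := Jskew z x0 u; rewrite lE Ju ipZl// ipZr// => E.
  apply: (mulfI l0); rewrite mulr0; lra.
exists x0, y; split=> //.
- move=> a b E; have E2 : a *: x0 - b *: y = 0.
    have := congr1 (J z) E; rewrite (bilinDr Jb) !(bilinZr Jb) lE Jy (bilin0r Jb).
    move=> /rowP E2; apply/rowP => i; have := E2 i; rewrite !mxE => E3.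
    by apply: (mulfI l0); rewrite mulr0 -[RHS]E3; ring.
  have ax : a *: x0 = 0.
    move: E E2 => /rowP E /rowP E2; apply/rowP => i.
    have := E i; have := E2 i; rewrite !mxE; lra.
  have a0 : a = 0 by move/eqP : ax; rewrite scaler_eq0 (negbTE x00) orbF => /eqP.
  split=> //; move/eqP : E; rewrite a0 scale0r add0r scaler_eq0 (negbTE y0) orbF.
  by move/eqP.
(* The coefficient comes from [J_anticomm] for z, s and x0 paired with y: both terms on its left
   equal l <J_s x0, y>, because J_z y = - l y. *)
- exists (- (c * ip x0 y / l)).
  apply: (ip_inj_center br_lie ip_inner center_nondeg).
  + exact: br_center.
  + exact: lie_centerZ.
  move=> s sc; rewrite [LHS]ipC// -ipJ ipZl//.
  have := congr1 (ip^~ y) (J_anticomm zc sc x0v).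
  rewrite ipDl// lE (bilinZr Jb) !ipZl// Jskew Jy ipZr// => E.
  apply: (mulfI l0).
  have -> : l * (- (c * ip x0 y / l) * ip z s) = - (c * ip x0 y * ip z s) by field.
  lra.
- split; first by exists l, 0; rewrite lE scale0r addr0.
  by exists 0, (- l); rewrite Jy scale0r add0r.
- by exists 1, 0; rewrite scale1r scale0r addr0.
Qed.

Theorem ex_totally_geodesic z x0 : Z z -> nonnull ip z -> X x0 ->
  exists H : set 'rV[R]_n,
    [/\ connected H, is_submanifold 3 H,
        totally_geodesic (left_invariant_metric br ip) H,
        H 0 /\ tangent H 0 (z + x0) &
        exists z', [/\ tangent H 0 z', Z z' & nonnull ip z']].
Proof.
move=> zc zn x0v.
have [x [y [[xv yv] ind [l lE] [[a1 [b1 Jx]] [a2 [b2 Jy]]] [a [b x0E]]]]] :=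
  J_plane zc zn x0v.
pose M : 'M[R]_(3, n) := \matrix_(i < 3) [:: z; x; y]`_i.
have inM (i : 'I_3) : ([:: z; x; y]`_i <= M)%MS.
  by rewrite -[[:: z; x; y]`_i](rowK (fun i : 'I_3 => [:: z; x; y]`_i)) row_sub.
have zM : (z <= M)%MS by exact: (inM 0).
have xM : (x <= M)%MS by exact: (inM 1).
have yM : (y <= M)%MS by exact: (inM (@Ordinal 3 2 isT)).
have cM p q : ((p *: x + q *: y)%R <= M)%MS.
  by apply: addmx_sub; apply: scalemx_sub.
have M0 (p q : 'rV[R]_n) : p = 0 -> (p <= M)%MS by move=> ->; exact: sub0mx.
have rf : row_free M.
  apply: inj_row_free => v; rewrite mulmx_sum_row !big_ord_recl big_ord0 addr0.
  rewrite !rowK /= => E.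
  have [] := @split0 _ _ _ _ ip_inner center_nondeg (v 0 0 *: z)
    (v 0 (lift ord0 ord0) *: x + v 0 (lift ord0 (lift ord0 ord0)) *: y) _ _ E.
  - exact: lie_centerZ.
  - by apply: XP => //; exact: XZ.
  move=> /eqP; rewrite scaler_eq0 (negbTE (nonnull_neq0 ip_inner zn)) orbF.
  move=> /eqP v0 /ind[v1 v2]; apply/rowP => i; rewrite mxE.
  case: (unliftP ord0 i) => [j ->|->//]; case: (unliftP ord0 j) => [k ->|->//].
  by rewrite ord1.
have tg : totally_geodesic (left_invariant_metric br ip) (span M).
  have zr u : br u z = 0 by exact: br_centerr.
  apply: span_totally_geodesic => // i j; rewrite !rowK.
    case: i j => [[|[|[|//]]] Hi] [[|[|[|//]]] Hj] /=;
      rewrite ?zr ?(zc _) ?brxx ?sub0mx//.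
      by rewrite lE scalemx_sub.
    by rewrite (brC br_lie) lE eqmx_opp scalemx_sub.
  case: i j => [[|[|[|//]]] Hi] [[|[|[|//]]] Hj] /=;
    rewrite ?(adj_center0 br_lie ip_inner _ zc) ?(adj_compl0 br_lie br_two_step ip_inner _ xv)
      ?(adj_compl0 br_lie br_two_step ip_inner _ yv) ?sub0mx//.
    by rewrite Jx.
  by rewrite Jy.
have s0 : ((0 : 'rV[R]_n) <= M)%MS by exact: sub0mx.
exists (span M); split => //.
- exact: span_connected.
- exact: span_submanifold.
- split; first exact: s0.
  by apply/tangent_span => //; rewrite x0E addmx_sub.
- by exists z; split=> //; apply/tangent_span.
Qed.

End PseudoHType.

(** * Tangent spaces of totally geodesic submanifolds *)

Section SliceCharts.
Context {R : realType} {n : nat} {k : nat} {H U : set 'rV[R]_n}.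
Context {Phi Psi : 'rV[R]_n -> 'rV[R]_n}.
Hypotheses (oU : open U) (oU' : open (Phi @` U)).
Hypotheses (Phis : smooth_on U Phi) (Psis : smooth_on (Phi @` U) Psi).
Hypothesis PhiK : forall q, U q -> Psi (Phi q) = q.
Hypothesis HU : forall q, U q -> (H q <-> forall j : 'I_n, (k <= j)%N -> Phi q 0 j = 0).

Let PhiU q : U q -> (Phi @` U) (Phi q). Proof. by exists q. Qed.

Let Phid q : U q -> differentiable Phi q.
Proof. exact: smooth_on_differentiable. Qed.

Let Psid q : U q -> differentiable Psi (Phi q).
Proof. by move=> Uq; apply: (smooth_on_differentiable Psis); exists q. Qed.

Lemma chart_derK q v : U q -> 'D_('D_v Phi q) Psi (Phi q) = v.
Proof.
move=> Uq; rewrite -(derive_chain v (Phid Uq) (Psid Uq)).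
transitivity ('D_v (id : 'rV[R]_n -> 'rV[R]_n) q); last exact: derive_id.
apply: near_eq_derive; apply: filterS (open_near oU Uq) => y Uy.
exact: PhiK.
Qed.

Lemma chart_derVK q e : U q -> 'D_('D_e Psi (Phi q)) Phi q = e.
Proof.
move=> Uq; have Pd : differentiable Phi (Psi (Phi q)) by rewrite PhiK//; exact: Phid.
have := derive_chain e (Psid Uq) Pd; rewrite [X in 'D__ Phi X](PhiK Uq) => <-.
transitivity ('D_e (id : 'rV[R]_n -> 'rV[R]_n) (Phi q)); last exact: derive_id.
apply: near_eq_derive; apply: filterS (open_near oU' (PhiU Uq)) => _ [y Uy <-].
by rewrite /= PhiK.
Qed.

(** In one direction, [Phi] along a curve in H has vanishing last coordinates, hence so has its
    velocity. In the other, the curve is a straight segment of the chart pulled back by [Psi]. *)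
Lemma tangent_slice q v : U q -> H q ->
  tangent H q v <-> forall j : 'I_n, (k <= j)%N -> 'D_v Phi q 0 j = 0.
Proof.
move=> Uq Hq; split=> [[c [c0 cd cH]] j kj|v0].
  have cdiff : differentiable c 0 by apply/derivable1_diffP; case: cd.
  have Pd : differentiable Phi (c 0) by rewrite c0; exact: Phid.
  have cc := differentiable_continuous cdiff.
  have cU : \forall s \near (0 : R), U (c s) by apply: cc; rewrite c0; exact: open_near.
  have := is_derive_chain cdiff cd Pd; rewrite c0 => /is_derive_mx/(_ 0 j)[_ <-].
  transitivity ('D_1 (fun _ : R => (0 : R)) 0); last exact: derive_cst.
  apply: near_eq_derive; apply: filterS2 cU cH => s Us Hs /=.
  exact: ((HU Us).1 Hs).
set e := 'D_v Phi q in v0.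
have l := is_derive_segment (Phi q) e 0.
have ld : differentiable (fun s : R => Phi q + s *: e) 0.
  by apply/derivable1_diffP; case: l.
have q0 : Phi q + (0 : R) *: e = Phi q by rewrite scale0r addr0.
have Pd : differentiable Psi (Phi q + (0 : R) *: e) by rewrite q0; exact: Psid.
exists (fun s : R => Psi (Phi q + s *: e)); split.
- by rewrite q0 PhiK.
- by have := is_derive_chain ld l Pd; rewrite q0 chart_derK.
- have lc := differentiable_continuous ld.
  have : \forall s \near (0 : R), (Phi @` U) (Phi q + s *: e).
    by apply: lc; rewrite q0; apply: open_near => //; exact: PhiU.
  apply: filterS => s [y Uy yE]; rewrite -yE PhiK//; apply/(HU Uy) => j kj.
  by rewrite yE !mxE (v0 j kj) mulr0 addr0; apply: ((HU Uq).1 Hq).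
Qed.

Lemma tangentP q a u w : U q -> H q ->
  tangent H q u -> tangent H q w -> tangent H q (a *: u + w).
Proof.
move=> Uq Hq /(tangent_slice _ Uq Hq) u0 /(tangent_slice _ Uq Hq) w0.
apply/(tangent_slice _ Uq Hq) => j kj.
rewrite (deriveDdir _ _ (Phid Uq)) (deriveZdir _ _ (Phid Uq)) !mxE.
by rewrite (u0 j kj) (w0 j kj) mulr0 addr0.
Qed.

(** The extension is a constant field of the chart carried back to U. *)
Lemma tangent_extends q v : U q -> H q -> tangent H q v ->
  exists2 V, tangent_field H U V & V q = v.
Proof.
move=> Uq Hq /(tangent_slice _ Uq Hq) v0; set e := 'D_v Phi q in v0.
exists (fun y => 'D_e Psi (Phi y)); last exact: chart_derK.
split=> [i|y Uy Hy].
  have [_ Pe] := Psis i.+1.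
  exact: (Ck_on_comp oU PhiU (Phis i) (Pe e)).
by apply/(tangent_slice _ Uy Hy) => j kj; rewrite chart_derVK// v0.
Qed.

End SliceCharts.

Lemma ker_row_neq0 {F : fieldType} {m p : nat} (A : 'M[F]_(m, p)) : (p < m)%N ->
  exists2 v : 'rV[F]_m, v != 0 & v *m A = 0.
Proof.
move=> pm; have /rowV0Pn[v vk vn] : kermx A != 0.
  by rewrite -mxrank_eq0 mxrank_ker subn_eq0 -ltnNge (leq_ltn_trans (rank_leq_col A)).
by exists v => //; exact/sub_kermxP.
Qed.

(** The differential of [Phi] is injective and sends tangent vectors to the first 3 coordinates; a
    nonzero row killed by the resulting 4 by 3 matrix holds the coefficients. *)
Lemma slice_dependent4 {R : realType} {n : nat} {H U : set 'rV[R]_n}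
    {Phi Psi : 'rV[R]_n -> 'rV[R]_n} :
  open U -> open (Phi @` U) -> smooth_on U Phi -> smooth_on (Phi @` U) Psi ->
  (forall q, U q -> Psi (Phi q) = q) ->
  (forall q, U q -> (H q <-> forall j : 'I_n, (3 <= j)%N -> Phi q 0 j = 0)) ->
  (3 <= n)%N -> forall q, U q -> H q -> dependent4 (tangent H q).
Proof.
move=> oU oU' Phis Psis PhiK HU n3 q Uq Hq u1 u2 u3 u4.
have tsl v : tangent H q v -> _ := (tangent_slice oU oU' Phis Psis PhiK HU v Uq Hq).1.
move=> /tsl t1 /tsl t2 /tsl t3 /tsl t4.
pose u (i : 'I_4) := [:: u1; u2; u3; u4]`_i.
have ut (i : 'I_4) (j : 'I_n) : (3 <= j)%N -> 'D_(u i) Phi q 0 j = 0.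
  by case: i => [[|[|[|[|//]]]] Hi]; [exact: t1|exact: t2|exact: t3|exact: t4].
pose A : 'M[R]_(4, 3) := \matrix_(i, j) 'D_(u i) Phi q 0 (widen_ord n3 j).
have [v vn vA] := ker_row_neq0 A isT.
have Phid := smooth_on_differentiable Phis Uq.
pose w := \sum_i v 0 i *: u i.
have wE : 'D_w Phi q = \sum_i v 0 i *: 'D_(u i) Phi q.
  rewrite deriveE// /w linear_sum; apply: eq_bigr => i _.
  by rewrite linearZ deriveE.
have w0 : w = 0.
  rewrite -(chart_derK oU Phis Psis PhiK w Uq) (_ : 'D_w Phi q = 0) ?derive0//.
  rewrite wE; apply/rowP => j; rewrite summxE [RHS]mxE.
  have [j3|j3] := leqP 3 j; first by apply: big1 => i _; rewrite mxE ut// mulr0.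
  have /rowP/(_ (Ordinal j3)) := vA; rewrite mxE [RHS]mxE => E; rewrite -[RHS]E.
  apply: eq_bigr => i _; rewrite !mxE; congr (_ * 'D_(u i) Phi q 0 _).
  exact: val_inj.
exists (v 0 0), (v 0 1), (v 0 (@Ordinal 4 2 isT)), (v 0 (@Ordinal 4 3 isT)); split.
  apply: contraNT vn; rewrite !negb_or !negbK => /and4P[/eqP v0 /eqP v1 /eqP v2 /eqP v3].
  apply/eqP/rowP => i; rewrite mxE.
  by case: i => [[|[|[|[|//]]]] Hi]; [rewrite -v0|rewrite -v1|rewrite -v2|rewrite -v3];
    congr (v _ _); exact: val_inj.
rewrite -w0 /w !big_ord_recl big_ord0 addr0 !addrA /u /=.
by congr (_ *: _ + _ *: _ + _ *: _ + _ *: _); congr (v _ _); exact: val_inj.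
Qed.

Lemma derive_dir {R : realType} {m n : nat} (U : set 'rV[R]_m)
    (B : 'rV[R]_m -> 'rV[R]_m) (c : 'rV[R]_m -> 'rV[R]_n) q u :
  open U -> smooth_on U B -> smooth_on U c -> U q ->
  'D_u (fun y => 'D_(B y) c y) q =
  'D_u (fun y => 'D_(B q) c y) q + 'D_('D_u B q) c q.
Proof.
move=> oU Bs cs Uq; have cd y := smooth_on_differentiable cs (x := y).
have Bd := smooth_on_differentiable Bs Uq.
have cid i : differentiable (fun y => 'D_(basis_vec i) c y) q.
  by have [_ /(_ (basis_vec i))[+ _]] := cs 2%N; apply.
have E1 : 'D_u (fun y => 'D_(B y) c y) q =
    'D_u (fun y => \sum_i (B y) 0 i *: 'D_(basis_vec i) c y) q.
  apply: near_eq_derive; apply: filterS (open_near oU Uq) => y Uy.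
  exact: derive_basis (cd y Uy).
have E2 : 'D_u (fun y => 'D_(B q) c y) q =
    'D_u (fun y => \sum_i (B q) 0 i *: 'D_(basis_vec i) c y) q.
  apply: near_eq_derive; apply: filterS (open_near oU Uq) => y Uy.
  exact: derive_basis (cd y Uy).
have D1 i := is_derive_bilin (bilin_coord i)
  (derivableP (@diff_derivable _ _ _ _ _ u Bd))
  (derivableP (@diff_derivable _ _ _ _ _ u (cid i))).
have D2 i := is_derive_bilin (bilin_coord i) (is_derive_cst (B q) q u)
  (derivableP (@diff_derivable _ _ _ _ _ u (cid i))).
have [_ F1] := is_derive_fsum D1; have [_ F2] := is_derive_fsum D2.
apply: etrans E1 (etrans F1 _); apply: esym.
apply: etrans (congr2 +%R (etrans E2 F2) (derive_basis _ (cd q Uq))) _.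
rewrite -big_split/=.
by apply: eq_bigr => i _; rewrite mxE scale0r add0r addrC.
Qed.

(** * Curvature of fields tangent to a totally geodesic submanifold *)

Section CurvatureInvariance.
Context {R : realType} {n : nat}.
Context {br : 'rV[R]_n -> 'rV[R]_n -> 'rV[R]_n} {ip : 'rV[R]_n -> 'rV[R]_n -> R}.
Hypothesis br_lie : is_lie_bracket br.
Hypothesis br_two_step : two_step_nilpotent br.
Hypothesis ip_inner : is_inner_product ip.
Let brb := br_bilin br_lie.
Let cb := conn_bilin br_lie ip_inner.
Local Notation g := (left_invariant_metric br ip).
Local Notation conn := (conn br ip).
Local Notation curv := (curv br ip).

Lemma is_derive_curv (V : normedModType R) (a b c : V -> 'rV[R]_n) da db dc x v :
  is_derive x v a da -> is_derive x v b db -> is_derive x v c dc ->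
  is_derive x v (fun q => curv (a q) (b q) (c q))
    (curv da (b x) (c x) + curv (a x) db (c x) + curv (a x) (b x) dc).
Proof.
move=> ad bd cd.
have d1 := is_derive_bilin cb ad (is_derive_bilin cb bd cd).
have d2 := is_derive_bilin cb bd (is_derive_bilin cb ad cd).
have d3 := is_derive_bilin cb (is_derive_bilin brb ad bd) cd.
apply: is_derive_eq (is_deriveB (is_deriveB d1 d2) d3) _.
rewrite /curv /= (bilinDl cb (br da _)) (bilinDr cb (a x)) (bilinDr cb (b x)).
suff P (p1 p2 p3 q1 q2 q3 r1 r2 r3 : 'rV[R]_n) :
    p1 + (p2 + p3) - (q2 + (q1 + q3)) - (r1 + r2 + r3) =
    p1 - q1 - r1 + (p2 - q2 - r2) + (p3 - q3 - r3) by exact: P.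
by apply/rowP => i; rewrite !mxE; ring.
Qed.

Lemma curvDl a a' b c : curv (a + a') b c = curv a b c + curv a' b c.
Proof.
rewrite /curv (bilinDl cb a) (bilinDl cb a a' c) (bilinDr cb b) (bilinDl brb).
rewrite (bilinDl cb (br a b)).
by rewrite 2!opprD [X in X + _ = _]addrACA [LHS]addrACA.
Qed.

Lemma curvDm a b b' c : curv a (b + b') c = curv a b c + curv a b' c.
Proof.
rewrite /curv (bilinDl cb b) (bilinDr cb a) (bilinDl cb b b' (conn a c)).
rewrite (bilinDr brb a) (bilinDl cb (br a b)).
by rewrite 2!opprD [X in X + _ = _]addrACA [LHS]addrACA.
Qed.

Lemma curvDr a b c c' : curv a b (c + c') = curv a b c + curv a b c'.
Proof.
rewrite /curv (bilinDr cb b) (bilinDr cb a c) (bilinDr cb a) (bilinDr cb b).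
rewrite (bilinDr cb (br a b)).
by rewrite 2!opprD [X in X + _ = _]addrACA [LHS]addrACA.
Qed.

(* Vector fields are written in the left trivialization throughout; [nab v w] is
   then the covariant derivative of w along v. *)
Definition nab (v w : 'rV[R]_n -> 'rV[R]_n) q : 'rV[R]_n :=
  'D_(luntriv br q (v q)) w q + conn (v q) (w q).

Section Fields.
Variable U : set 'rV[R]_n.
Hypothesis oU : open U.

Lemma smooth_luntriv w : smooth_on U w -> smooth_on U (fun q => luntriv br q (w q)).
Proof.
move=> ws k; apply: Ck_on_add => //; rewrite /=.
have bs : bilin (fun x y => 2^-1 *: br x y).
  split=> a x *; rewrite ?brb.1 ?brb.2; apply/rowP => i; rewrite !mxE; ring.
by apply: (Ck_on_bilin oU bs) => //; exact: Ck_on_id.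
Qed.

Lemma smooth_ltriv w : smooth_on U w -> smooth_on U (fun q => ltriv br q (w q)).
Proof.
move=> ws k; apply: Ck_on_add => //; rewrite /=.
have bs : bilin (fun x y => - (2^-1 *: br x y)).
  split=> a x *; rewrite ?brb.1 ?brb.2; apply/rowP => i; rewrite !mxE; ring.
by apply: (Ck_on_bilin oU bs) => //; exact: Ck_on_id.
Qed.

Lemma smooth_nab v w : smooth_on U v -> smooth_on U w -> smooth_on U (nab v w).
Proof.
move=> vs ws k; apply: Ck_on_add => //; last exact: (Ck_on_bilin oU cb).
exact: (Ck_on_dir oU (smooth_luntriv vs k) (ws k.+1)).
Qed.

Lemma derive_nab v w q u : smooth_on U v -> smooth_on U w -> U q ->
  'D_u (nab v w) q = 'D_u (fun y => 'D_(luntriv br q (v q)) w y) q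
    + 'D_('D_u v q + 2^-1 *: (br u (v q) + br q ('D_u v q))) w q
    + (conn ('D_u v q) (w q) + conn (v q) ('D_u w q)).
Proof.
move=> vs ws Uq; have vd := smooth_on_differentiable vs Uq.
have wd := smooth_on_differentiable ws Uq.
have ls := smooth_luntriv vs.
have dd : differentiable (fun y => 'D_(luntriv br y (v y)) w y) q.
  have s1 : Ck_on 1 U (fun y => 'D_(luntriv br y (v y)) w y).
    exact: (Ck_on_dir oU (ls 1%N) (ws 2%N)).
  exact: s1.1 q Uq.
have i1 := derivableP (@diff_derivable _ _ _ _ _ u dd).
have i2 := is_derive_bilin cb (derivableP (@diff_derivable _ _ _ _ _ u vd))
  (derivableP (@diff_derivable _ _ _ _ _ u wd)).
have [_ E] := is_deriveD i1 i2.
apply: etrans E _; congr (_ + _); apply: etrans (derive_dir u oU ls ws Uq) _.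
congr (_ + derive w q _).
by have [_ ->] := is_derive_luntriv br_lie (is_derive_id q u)
  (derivableP (@diff_derivable _ _ _ _ _ u vd)).
Qed.

Let nab_nab a b c q : smooth_on U a -> smooth_on U b -> smooth_on U c -> U q ->
  let A := luntriv br q (a q) in let B := luntriv br q (b q) in
  nab a (nab b c) q = 'D_A (fun y => 'D_B c y) q
    + 'D_('D_A b q + 2^-1 *: (br (a q) (b q) + br q ('D_A b q))) c q
    + (conn ('D_A b q) (c q) + conn (b q) ('D_A c q))
    + (conn (a q) ('D_B c q) + conn (a q) (conn (b q) (c q))).
Proof.
move=> sa sb sc Uq A B; rewrite -(bilinDr cb); congr (_ + _).
apply: etrans (derive_nab A sb sc Uq) _.
have -> // : br A (b q) = br (a q) (b q).
by rewrite /A /luntriv (bilinDl brb) (bilinZl brb) (br_center br_lie br_two_step)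
   scaler0 addr0.
Qed.

(** The connection is torsion free, so [nab a b - nab b a] stands for the Lie bracket of fields and
    the left side is built from [nab] alone, which preserves tangency to H. Second derivatives of c
    cancel by symmetry, and the first derivatives of a, b and c cancel among the three terms. *)
Lemma nab_curv a b c q : smooth_on U a -> smooth_on U b -> smooth_on U c -> U q ->
  nab a (nab b c) q - nab b (nab a c) q - nab (fun y => nab a b y - nab b a y) c q
  = curv (a q) (b q) (c q).
Proof.
move=> sa sb sc Uq; have cd := smooth_on_differentiable sc Uq.
set A := luntriv br q (a q); set B := luntriv br q (b q).
have N1 := nab_nab sa sb sc Uq; have N2 := nab_nab sb sa sc Uq.
have S := Ck_derive_comm B A oU (sc 2%N) Uq.
have N3 : nab (fun y => nab a b y - nab b a y) c q =
    'D_('D_A b q + 2^-1 *: (br (a q) (b q) + br q ('D_A b q))) c q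
    - 'D_('D_B a q + 2^-1 *: (br (b q) (a q) + br q ('D_B a q))) c q
    + (conn ('D_A b q) (c q) - conn ('D_B a q) (c q)
       + conn (br (a q) (b q)) (c q)).
  pose w := 'D_A b q - 'D_B a q + br (a q) (b q).
  have wE : nab a b q - nab b a q = w.
    rewrite /w -(conn_torsion br_lie (ip := ip)) /nab -/A -/B.
    suff P (x1 x2 x3 x4 : 'rV[R]_n) : x1 + x2 - (x3 + x4) = x1 - x3 + (x2 - x4) by exact: P.
    by rewrite opprD addrACA.
  have E1 : conn w (c q) = conn ('D_A b q) (c q) - conn ('D_B a q) (c q)
       + conn (br (a q) (b q)) (c q).
    by rewrite (bilinDl cb _ (br (a q) (b q))) (bilinBl cb).
  rewrite {1}/nab wE E1; congr (_ + _).
  apply: etrans (_ : 'D_(('D_A b q + 2^-1 *: (br (a q) (b q) + br q ('D_A b q)))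
    + (-1) *: ('D_B a q + 2^-1 *: (br (b q) (a q) + br q ('D_B a q)))) c q = _).
    congr (derive c q _); rewrite /luntriv /w (brC br_lie (b q)).
    rewrite (bilinDr brb q) (bilinBr brb q) (br_two_step.2 q).
    move: ('D_A b q) ('D_B a q) => x1 x2.
    move: (br q _) (br q _) (br _ _) => y1 y2 y3.
    by apply/rowP => i; rewrite !mxE; field.
  by rewrite (deriveDdir _ _ cd) (deriveZdir _ _ cd) scaleN1r.
rewrite N1 N2 N3 /=.
suff P (s s' x1 x2 k1 k2 k3 k4 k5 k6 k7 : 'rV[R]_n) : s = s' ->
    s + x1 + (k1 + k2) + (k3 + k4) - (s' + x2 + (k5 + k3) + (k2 + k6))
    - (x1 - x2 + (k1 - k5 + k7)) = k4 - k6 - k7 by apply: P; exact: S.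
by move=> ->; apply/rowP => i; rewrite !mxE; ring.
Qed.

Variable H : set 'rV[R]_n.
Hypothesis H_geodesic : totally_geodesic g H.
Hypothesis tanP : forall q a u w, U q -> H q ->
   tangent H q u -> tangent H q w -> tangent H q (a *: u + w).

Definition triv_tangent w :=
  smooth_on U w /\ forall q, U q -> H q -> tangent H q (luntriv br q (w q)).

Lemma triv_tangent_lin a v w : triv_tangent v -> triv_tangent w ->
  triv_tangent (fun q => a *: v q + w q).
Proof.
move=> [vs vt] [ws wt]; split=> [k|q Uq Hq]; last first.
  by rewrite luntrivP//; apply: tanP => //; [exact: vt|exact: wt].
apply: Ck_on_add => //.
apply: (Ck_on_ext (f := fun q => v q *m a%:M)) => // [q _|].
  by rewrite mul_mx_scalar.
exact: (smooth_on_mulmx _ oU vs).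
Qed.

Lemma triv_tangent_ext v w : (forall q, U q -> v q = w q) ->
  triv_tangent v -> triv_tangent w.
Proof.
move=> vw [vs vt]; split=> [k|q Uq Hq]; first exact: Ck_on_ext (vs k).
by rewrite -vw//; exact: vt.
Qed.

Lemma triv_tangentB v w : triv_tangent v -> triv_tangent w ->
  triv_tangent (fun q => v q - w q).
Proof.
move=> tv tw; apply: triv_tangent_ext (triv_tangent_lin (-1) tw tv) => q _ /=.
by rewrite scaleN1r addrC.
Qed.

Lemma triv_tangent_nab v w : triv_tangent v -> triv_tangent w ->
  triv_tangent (nab v w).
Proof.
move=> [vs vt] [ws wt]; split=> [|q Uq Hq]; first exact: smooth_nab.
pose V y := luntriv br y (v y); pose W y := luntriv br y (w y).
have Ws : smooth_on U W by exact: smooth_luntriv.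
have eW : (fun y => ltriv br y (W y)) = w by apply/funext => y; exact: luntrivK.
have E : ltriv br q (levi_civita g V W q) = nab v w q.
  apply: etrans (levi_civita_ltriv br_lie br_two_step ip_inner V
    (smooth_on_differentiable Ws Uq)) _.
  by rewrite eW; congr (_ + conn _ _); exact: luntrivK.
rewrite -E ltrivK//.
exact: H_geodesic oU (conj (smooth_luntriv vs) vt) (conj Ws wt) q Uq Hq.
Qed.

Lemma triv_tangent_curv a b c : triv_tangent a -> triv_tangent b ->
  triv_tangent c -> triv_tangent (fun q => curv (a q) (b q) (c q)).
Proof.
move=> ta tb tc.
have := triv_tangentB (triv_tangentB (triv_tangent_nab ta (triv_tangent_nab tb tc))
   (triv_tangent_nab tb (triv_tangent_nab ta tc)))
   (triv_tangent_nab (triv_tangentB (triv_tangent_nab ta tb) (triv_tangent_nab tb ta)) tc).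
apply: triv_tangent_ext => q Uq; apply: nab_curv => //.
- by case: ta.
- by case: tb.
- by case: tc.
Qed.

(** [curv] has constant coefficients in the trivialization, so by the product rule every derivative
    cancels and only the terms in [conn] survive. *)
Lemma nab_nabla_curv d a b c q :
  smooth_on U a -> smooth_on U b -> smooth_on U c -> U q ->
  nab d (fun y => curv (a y) (b y) (c y)) q - curv (nab d a q) (b q) (c q)
    - curv (a q) (nab d b q) (c q) - curv (a q) (b q) (nab d c q)
  = nabla_curv br ip (d q) (a q) (b q) (c q).
Proof.
move=> sa sb sc Uq; rewrite /nab /nabla_curv; set D := luntriv br q (d q).
have dv (f : 'rV[R]_n -> 'rV[R]_n) : smooth_on U f -> is_derive q D f ('D_D f q).
  by move=> fs; apply/derivableP/diff_derivable; exact: smooth_on_differentiable Uq.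
have [_ E] := is_derive_curv (dv a sa) (dv b sb) (dv c sc).
rewrite [X in X + _ - _ - _ - _]E curvDl curvDm curvDr.
suff P (x1 x2 x3 x4 x5 x6 x7 : 'rV[R]_n) :
    x1 + x2 + x3 + x4 - (x1 + x5) - (x2 + x6) - (x3 + x7) = x4 - x5 - x6 - x7 by exact: P.
by apply/rowP => i; rewrite !mxE; ring.
Qed.

Lemma triv_tangent_nabla_curv d a b c : triv_tangent d -> triv_tangent a ->
  triv_tangent b -> triv_tangent c ->
  triv_tangent (fun q => nabla_curv br ip (d q) (a q) (b q) (c q)).
Proof.
move=> td ta tb tc.
have := triv_tangentB (triv_tangentB (triv_tangentB
   (triv_tangent_nab td (triv_tangent_curv ta tb tc))
   (triv_tangent_curv (triv_tangent_nab td ta) tb tc))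
   (triv_tangent_curv ta (triv_tangent_nab td tb) tc))
   (triv_tangent_curv ta tb (triv_tangent_nab td tc)).
apply: triv_tangent_ext => q Uq; apply: nab_nabla_curv => //.
- by case: ta.
- by case: tb.
- by case: tc.
Qed.

End Fields.

Lemma luntriv0 u : luntriv br 0 u = u.
Proof. by rewrite /luntriv (bilin0l brb) scaler0 addr0. Qed.

Lemma ltriv0 u : ltriv br 0 u = u.
Proof. by rewrite /ltriv (bilin0l brb) scaler0 subr0. Qed.

(** Tangent vectors at 0 extend to trivialized fields tangent along H; the statements for fields are
    then evaluated at 0, where [luntriv] is the identity. *)
Theorem tangent_curvature_invariant H : is_submanifold 3 H ->
  totally_geodesic g H -> H 0 -> curvature_invariant (br := br) (ip := ip) (tangent H 0).
Proof.
move=> [n3 Hs] Hg H0; have [U [Phi [Psi [[oU U0] oU' [Phis Psis] PhiK HU]]]] := Hs 0 H0.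
have tanP q a u w := @tangentP _ _ _ _ _ _ _ oU oU' Phis Psis PhiK HU q a u w.
have ext u : tangent H 0 u -> exists2 w, triv_tangent U H w & w 0 = u.
  move=> tu; have [V [Vs Vt] V0] := tangent_extends oU oU' Phis Psis PhiK HU U0 H0 tu.
  exists (fun q => ltriv br q (V q)); last by rewrite ltriv0.
  by split=> [|q Uq Hq]; [exact: smooth_ltriv|rewrite ltrivK//; exact: Vt].
split.
- by move=> a u w; exact: tanP.
- move=> _ _ _ /ext[a ta <-] /ext[b tb <-] /ext[c tc <-].
  have [_ /(_ 0 U0 H0)] := triv_tangent_curv oU Hg tanP ta tb tc.
  by rewrite luntriv0.
- move=> _ _ _ _ /ext[d td <-] /ext[a ta <-] /ext[b tb <-] /ext[c tc <-].
  have [_ /(_ 0 U0 H0)] := triv_tangent_nabla_curv oU Hg tanP td ta tb tc.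
  by rewrite luntriv0.
- exact: (slice_dependent4 oU oU' Phis Psis PhiK HU n3 U0 H0).
Qed.

End CurvatureInvariance.

(** * Existence of geodesics *)

Section LinearODE.
Context {R : realType} {n : nat} (A : 'M[R]_n) (x0 : 'rV[R]_n).

Let y k : 'rV[R]_n := iter k (fun u => u *m A) x0.
Let M : R := \sum_i \sum_j `|A j i|.
Let B : R := \sum_j `|x0 0 j|.

Let M0 : 0 <= M. Proof. by apply: sumr_ge0 => i _; apply: sumr_ge0. Qed.

Let y_bound k i : `|y k 0 i| <= B * M ^+ k.
Proof.
elim: k i => [|k IH] i.
  by rewrite expr0 mulr1 /B (bigD1 i)//= lerDl; apply: sumr_ge0.
rewrite /y iterS -/(y k) mxE; apply: le_trans (ler_norm_sum _ _ _) _.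
apply: (@le_trans _ _ (\sum_j B * M ^+ k * `|A j i|)).
  by apply: ler_sum => j _; rewrite normrM ler_wpM2r.
rewrite -mulr_sumr exprSr mulrA; apply: ler_wpM2l.
  exact: le_trans (normr_ge0 _) (IH i).
rewrite /M [leRHS](bigD1 i)//= lerDl; apply: sumr_ge0 => j _; exact: sumr_ge0.
Qed.

Let sd i m : pseries_diffs (fun k => y (m + k) 0 i / k`!%:R) = fun k => y (m.+1 + k) 0 i / k`!%:R.
Proof.
apply/funext => k; rewrite /pseries_diffs factS natrM addSnnS invfM mulrCA.
by rewrite mulVKf// pnatr_eq0.
Qed.

Let s_cvg i m (K : R) : cvgn (pseries (fun k => y (m + k) 0 i / k`!%:R) K).
Proof.
apply: normed_cvg; have B0 : 0 <= B by exact: sumr_ge0.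
apply: (@series_le_cvg _ _ (fun k => B * M ^+ m * exp_coeff (M * `|K|) k)).
- move=> k; exact: normr_ge0.
- move=> k; apply: mulr_ge0; first by rewrite mulr_ge0 ?exprn_ge0.
  by apply: exp_coeff_ge0; exact: mulr_ge0.
- move=> k; rewrite /= !normrM normfV normrX [`|_%:R|]ger0_norm ?ler0n//.
  rewrite /exp_coeff /= exprMn [_ * (_ * _ / _)]mulrA.
  rewrite [leLHS]mulrAC ler_wpM2r ?invr_ge0 ?ler0n// mulrA ler_wpM2r ?exprn_ge0//.
  by rewrite -mulrA -exprD.
have := @is_cvg_seriesZ _ _ (B * M ^+ m) (is_cvg_series_exp_coeff (M * `|K|)).
by congr (cvgn (series _)); apply/funext => k.
Qed.

(** The curve is x0 exp(t A): [f m i] is the series of the i-th coordinate of x0 A^m exp(t A), so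
    termwise differentiation takes [f 0] to [f 1]. *)
Lemma ex_linear_curve : exists c : R -> 'rV[R]_n,
  c 0 = x0 /\ forall t, is_derive t (1 : R) c (c t *m A).
Proof.
pose f m i t := limn (pseries (fun k => y (m + k) 0 i / k`!%:R) t).
have fd i t : is_derive t (1 : R) (f 0%N i) (f 1%N i t).
  (* Termwise differentiation at t asks for convergence at a point of larger modulus, here |t| +
     1. *)
  have := @pseries_snd_diffs _ (fun k => y (0 + k) 0 i / k`!%:R) (`|t| + 1) t.
  rewrite !sd => H; apply: H; try exact: s_cvg.
  by rewrite [ltRHS]ger0_norm ?addr_ge0// ltrDl.
have f1 i t : f 1%N i t = \sum_j f 0%N j t * A j i.
  rewrite /f; apply: cvg_lim => //.
  rewrite (_ : pseries _ t = fun N => \sum_j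
    pseries (fun k => y (0 + k) 0 j / k`!%:R) t N * A j i).
    elim: (index_enum _) => [|j r IH].
      by under eq_fun do rewrite big_nil; rewrite big_nil; exact: cvg_cst.
    under eq_fun do rewrite big_cons; rewrite big_cons; apply: cvgD IH.
    by apply: cvgMr_tmp; exact: s_cvg.
  apply/funext => N; rewrite /pseries /series /=.
  under [RHS]eq_bigr do rewrite mulr_suml.
  rewrite exchange_big /=; apply: eq_bigr => k _.
  rewrite mxE !mulr_suml.
  by apply: eq_bigr => j _; ring.
exists (fun t => \row_i f 0%N i t); split.
  apply/rowP => i; rewrite mxE /f; apply: cvg_lim => //.
  apply: cvg_near_cst; near=> N; have N0 : (0 < N)%N by near: N; exists 1%N.
  rewrite /pseries /series /= -(prednK N0) big_nat_recl// big1 => [|k _].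
    by rewrite expr0 addr0 mulr1 fact0 divr1.
  by rewrite expr0n /= mulr0.
move=> t; apply/is_derive_mx => i j; rewrite ord1.
rewrite (_ : (fun z => _) = f 0%N j); last by apply/funext => z; rewrite mxE.
apply: is_derive_eq (fd j t) _; rewrite f1 mxE.
by apply: eq_bigr => l _; rewrite mxE.
Unshelve. all: by end_near. Qed.

End LinearODE.

Section Antiderivative.
Context {R : realType}.

Lemma ex_antiderivative (L : R) (f : R -> R) : 0 < L ->
  (forall t, -L <= t <= L -> {for t, continuous f}) ->
  exists F : R -> R, F 0 = 0 /\
    forall t : R, -L < t < L -> is_derive t (1 : R) F (f t).
Proof.
move=> L0 fc; have fL : (@lebesgue_measure R).-integrable `[-L, L] (EFin \o f).
  apply: continuous_compact_integrable; first exact: segment_compact.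
  apply: continuous_in_subspaceT => t; rewrite inE /= in_itv /=; exact: fc.
pose F (x : R) := (\int[@lebesgue_measure R]_(t in `[(- L)%R, x]) (f t))%R.
exists (fun t => F t - F 0); split; first by rewrite subrr.
move=> t /andP[t0 t1]; have [Fd FE] := continuous_FTC1_closed t1 fL t0
  (fc t (introT andP (conj (ltW t0) (ltW t1)))).
have FD : is_derive t (1 : R) F (f t).
  exact: DeriveDef Fd (etrans (esym (derive1E F t)) FE).
apply: is_derive_eq (is_deriveB FD (is_derive_cst (F 0) _ _)) _.
by rewrite subr0.
Qed.

Lemma ex_antiderivative_row {n : nat} (L : R) (f : R -> 'rV[R]_n) : 0 < L ->
  (forall t, -L <= t <= L -> {for t, continuous f}) ->
  exists F : R -> 'rV[R]_n, F 0 = 0 /\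
    forall t : R, -L < t < L -> is_derive t (1 : R) F (f t).
Proof.
move=> L0 fc.
have fci i t : -L <= t <= L -> {for t, continuous (fun t => f t 0 i)}.
  by move=> tL; exact: (continuous_comp (fc t tL) (@coord_continuous R 1 n 0 i _)).
have /choice[F FP] i := ex_antiderivative L0 (fci i).
exists (fun t => \row_i F i t); split.
  by apply/rowP => i; rewrite !mxE; have [] := FP i.
move=> t tI; apply/is_derive_mx => i j; rewrite ord1.
rewrite (_ : (fun z => _) = F j); last by apply/funext => z; rewrite mxE.
by have [_] := FP j; exact.
Qed.

End Antiderivative.

Section Geodesics.
Context {R : realType} {n : nat}.
Context {br : 'rV[R]_n -> 'rV[R]_n -> 'rV[R]_n} {ip : 'rV[R]_n -> 'rV[R]_n -> R}.
Hypothesis br_lie : is_lie_bracket br.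
Hypothesis br_two_step : two_step_nilpotent br.
Hypothesis ip_inner : is_inner_product ip.
Hypothesis center_nondeg : nondegenerate_on ip (lie_center br).
Let brb := br_bilin br_lie.
Let Jb := adj_bilin br_lie ip_inner.
Local Notation J := (adj br ip).
Local Notation Z := (lie_center br).
Local Notation X := (center_compl br ip).
Local Notation g := (left_invariant_metric br ip).

(** J_z kills the center and takes values in v, so the projection to v of a solution in n is again a
    solution. *)
Lemma ex_adj_curve z x0 : X x0 -> exists a : R -> 'rV[R]_n,
  [/\ a 0 = x0, forall t, X (a t) &
      forall t, is_derive t (1 : R) a (J z (a t))].
Proof.
move=> x0v; pose A : 'M[R]_n := \matrix_i J z (basis_vec i).
have AE u : u *m A = J z u.
  rewrite mulmx_sum_row {2}[u]row_sum_basis bilin_sumr//.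
  by apply: eq_bigr => i _; rewrite rowK bilinZr.
have [c [c0 cd]] := ex_linear_curve A x0.
exists (fun t => c t *m compl_proj br ip); split.
- by rewrite c0 compl_proj_id.
- by move=> t; exact: compl_projP.
move=> t; apply: is_derive_eq (is_derive_mulmx (compl_proj br ip) (cd t)) _.
rewrite AE (compl_proj_id br_lie ip_inner center_nondeg (adj_compl br_lie ip_inner _ _)).
rewrite {1}(center_split (br := br) (ip := ip) (c t)) (bilinDr Jb).
by rewrite (adj_center0 br_lie ip_inner) ?add0r//; exact: center_projP.
Qed.

Lemma is_derive_continuous {V : normedModType R} (f : R -> V) (df : R -> V) :
  (forall t, is_derive t (1 : R) f (df t)) -> continuous f.
Proof.
move=> fd t; apply: differentiable_continuous; apply/derivable1_diffP.
by case: (fd t).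
Qed.

Lemma near_unit_itv (t : R) : -1 < t < 1 -> \forall s \near t, -1 < s < 1.
Proof.
move=> t1; have : t \in `]-1, 1[%R by rewrite in_itv.
by move=> /near_in_itvoo; apply: filterS => s; rewrite in_itv.
Qed.

(* In the left trivialization the velocity of a geodesic is z0 + exp(t J_z0) x0. *)
Lemma ex_geodesic z0 x0 : Z z0 -> X x0 -> exists gamma : R -> 'rV[R]_n,
  [/\ is_geodesic g [set t | -1 < t < 1] gamma, gamma 0 = 0 &
      derive1 gamma 0 = z0 + x0].
Proof.
move=> z0c x0v; have [a [a0 av ad]] := ex_adj_curve z0 x0v.
have ac := is_derive_continuous ad.
(* The interval ]-2, 2[ makes f below continuous on the closed interval [-1, 1], as the second
   integration requires. *)
have [x [xx0 xd]] := @ex_antiderivative_row R n 2 a (ltr0Sn _ 1) (fun t _ => ac t).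
(* The geodesic must have velocity z0 + a + [x, a] / 2; the part a integrates to x, and f is the
   central rest. *)
pose f t := z0 + 2^-1 *: br (x t) (a t).
have fZ t : Z (f t).
  by rewrite /f addrC; apply: lie_centerP => //; exact: br_center.
have fc (t : R) : -1 <= t <= 1 -> {for t, continuous f}.
  move=> /andP[t1 t2]; have t22 : -2 < t < 2 by apply/andP; split; lra.
  have [d _] := is_deriveD (is_derive_cst z0 t 1) (@is_deriveZ _ _ _ _ 2^-1 _ _ _
    (is_derive_bilin brb (xd t t22) (ad t))).
  exact/differentiable_continuous/derivable1_diffP.
have [F [F0 Fd]] := @ex_antiderivative_row R n 1 f ltr01 fc.
(* Projection makes z central for every t and keeps the derivative, since f is central. *)
pose z t := F t *m center_proj br ip.
have zZ t : Z (z t) by exact: center_projP.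
have zd (t : R) : -1 < t < 1 -> is_derive t (1 : R) z (f t).
  move=> t1; apply: is_derive_eq (is_derive_mulmx _ (Fd t t1)) _.
  exact: center_proj_id.
pose gam t := x t + z t; pose b t := z0 + a t.
have brz t u : br (z t) u = 0 by exact: zZ.
have brz0 u : br z0 u = 0 by exact: z0c.
have brz0r u : br u z0 = 0 by exact: br_centerr.
have gd (t : R) : -1 < t < 1 -> is_derive t (1 : R) gam (luntriv br (gam t) (b t)).
  move=> t1; have t22 : -2 < t < 2 by case/andP: t1 => *; apply/andP; split; lra.
  apply: is_derive_eq (is_deriveD (xd t t22) (zd t t1)) _.
  rewrite /luntriv /gam /b /f (bilinDl brb) brz addr0 (bilinDr brb) brz0r add0r.
  by rewrite addrCA addrA.
have bd t : is_derive t (1 : R) b (J z0 (a t)).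
  by apply: is_derive_eq (is_deriveD (is_derive_cst z0 t 1) (ad t)) _; rewrite add0r.
have g1 (t : R) : -1 < t < 1 -> derive1 gam t = luntriv br (gam t) (b t).
  by move=> t1; rewrite derive1E; have [_ ->] := gd t t1.
have g2 (t : R) : -1 < t < 1 ->
    is_derive t (1 : R) (derive1 gam) (luntriv br (gam t) (J z0 (a t))).
  move=> t1; have := is_derive_luntriv br_lie (gd t t1) (bd t).
  (* The velocity differs from b by a central vector, and [b, b] = 0. *)
  have -> : br (luntriv br (gam t) (b t)) (b t) = 0.
    rewrite /luntriv (bilinDl brb) (bilinZl brb) brxx//.
    by rewrite (br_center br_lie br_two_step) scaler0 addr0.
  rewrite add0r; apply: near_eq_is_derive.
  by apply: filterS (near_unit_itv t1) => s s1; rewrite g1.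
have m11 : -1 < (0 : R) < 1 by apply/andP; split; lra.
exists gam; split.
- split.
  + rewrite (_ : [set t | _] = `]-1, 1[%classic); first exact: interval_open.
    by apply/seteqP; split=> t; rewrite /= in_itv.
  + by move=> u w /= /andP[u1 _] /andP[_ w1] t /andP[ut tw]; apply/andP; split; lra.
  + move=> t /= t1; have [d1 _] := gd t t1; have [d2 E2] := g2 t t1.
    have e2 := etrans (derive1E (derive1 gam) t) E2.
    split; [exact: d1|exact: d2|rewrite e2 (g1 t t1)].
    apply: (can_inj (ltrivK br_lie br_two_step (gam t))).
    rewrite -[X in X + _]scale1r ltrivP// scale1r luntrivK//.
    rewrite christoffelE// luntrivK//.
    have -> : J (b t) (b t) = J z0 (a t).
      rewrite /b (bilinDr Jb) !(bilinDl Jb) !(adj_center0 br_lie ip_inner _ z0c).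
      by rewrite (adj_compl0 br_lie br_two_step ip_inner _ (av t)) !add0r addr0.
    rewrite /ltriv (bilin0r brb) scaler0 subr0.
    by apply/rowP => i; rewrite !mxE; field.
- by rewrite /gam xx0 /z F0 mul0mx addr0.
- rewrite g1// /gam xx0 /z F0 mul0mx addr0 /b a0 /luntriv (bilin0l brb).
  by rewrite scaler0 addr0.
Qed.

End Geodesics.

Lemma ip_normN0 {R : realType} {n : nat} (ip : 'rV[R]_n -> 'rV[R]_n -> R) x :
  ip_norm ip x <> 0 <-> nonnull ip x.
Proof.
rewrite /ip_norm /nonnull; split=> [H|H /eqP]; last first.
  by rewrite sqrtr_eq0 normr_le0 (negbTE H).
by apply: contra_notN H => /eqP ->; rewrite normr0 sqrtr0.
Qed.

Theorem theorem2p4 (R : realType) (n : nat)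
    (br : 'rV[R]_n -> 'rV[R]_n -> 'rV[R]_n)
    (ip : 'rV[R]_n -> 'rV[R]_n -> R)
    (br_lie : is_lie_bracket br)
    (br_two_step : two_step_nilpotent br)
    (ip_inner : is_inner_product ip)
    (center_nondeg : nondegenerate_on ip (lie_center br))
    (N_pseudoregular : pseudoregular br ip) :
  (forall (I : set R) (gamma : R -> 'rV[R]_n) (z0 x0 : 'rV[R]_n),
      I 0 ->
      is_geodesic (left_invariant_metric br ip) I gamma ->
      gamma 0 = 0 ->
      lie_center br z0 ->
      center_compl br ip x0 ->
      derive1 gamma 0 = z0 + x0 ->
      ip_norm ip z0 <> 0 ->
      exists H : set 'rV[R]_n,
        [/\ connected H,
            is_submanifold 3 H,
            totally_geodesic (left_invariant_metric br ip) H,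
            H 0 /\ tangent H 0 (derive1 gamma 0) &
            exists z' : 'rV[R]_n,
              [/\ tangent H 0 z', lie_center br z' & nonnull ip z']])
  <-> homothetic_to_pseudoH_type br ip.
Proof.
have hP := homothetic_pseudoHP br_lie ip_inner center_nondeg.
split=> [geo|/hP[c c0 J2] I gamma z0 x0 _ _ _ z0c x0v -> /ip_normN0 z0n]; last first.
  exact: (ex_totally_geodesic br_lie br_two_step ip_inner center_nondeg c0 J2).
apply/hP; apply: J2_homothety => // z x zc zn xv x0.
have [gam [gg g0 gE]] := ex_geodesic br_lie br_two_step ip_inner center_nondeg zc xv.
have I0 : [set t : R | -1 < t < 1] 0 by apply/andP; split; lra.
have [H [_ Hs Hg [H0 Ht] [z' [tz' z'c z'n]]]] :=
  geo _ gam z x I0 gg g0 zc xv gE ((ip_normN0 ip z).2 zn).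
exists (tangent H 0), z'; split=> //; last by rewrite -gE.
exact: tangent_curvature_invariant.
Qed.
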